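(* Let $0<\epsilon\le 1/256$, $s=\lfloor 1/(16\epsilon)\rfloor$, and let $d=d_s$, $n$ and $G=\mathbb F_2^{\,n}$ be as in the context. There exist an admissible HLM realization $(\xi_i)_{1\le i\le s}$ with averaged witness $f:G\to[0,1]$, a threshold $\theta=(c_0+1)/s$ with $c_0\in\{0,\dots,s-1\}$ an integer, and an integer $m$ satisfying $$16\mid m,\qquad \frac{2d}{\sqrt s}\le m\le\frac d2,$$ such that the set $S:=\{x\in G:f(x)\ge\theta\}$ satisfies $$\operatorname{ldr}^*_\epsilon(S)\ge\frac m{16}\ge\frac d{8\sqrt s}\ge\operatorname{twr}(s-2).$$ Consequently $\operatorname{dist}_G\bigl(S,\mathcal S_{m/16}(G)\bigr)>\epsilon$. The same realization still satisfies $\operatorname{reg}_\epsilon(f)=2^n\ge\operatorname{twr}(s)$.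
   Context: Tower function: $\operatorname{twr}(0)=1$, $\operatorname{twr}(r+1)=2^{\operatorname{twr}(r)}$. For $u,v\in\mathbb F_2^m$, $\langle u,v\rangle=\sum_j u_jv_j\in\mathbb F_2$. Ladders: a ladder of length $k$ in $A\subseteq G$ consists of $a_1,\dots,a_k,b_1,\dots,b_k\in G$ with $a_p+b_q\in A\iff p\le q$ for all $1\le p,q\le k$. $A$ is $k$-stable if it contains no ladder of length $k$; $\mathcal S_k(G)$ is the family of $k$-stable subsets of $G$. The ladder index $\operatorname{ldr}(A)$ is the largest $k$ for which $A$ contains a ladder of length $k$, with $\operatorname{ldr}(\emptyset)=0$. For $\eta\in[0,1]$, $\operatorname{ldr}^*_\eta(A)=\min\{\operatorname{ldr}(A\triangle B):B\subseteq G,\ |B|\le\eta|G|\}$. For a nonempty family $\mathcal C$ of subsets of $G$, $\operatorname{dist}_G(A,\mathcal C)=\min_{C\in\mathcal C}|A\triangle C|/|G|$. Regularity: for a subspace $H\le G$, $f:G\to[0,1]$ and $x,t\in G$, put $\widehat f_{x+H}(t)=\frac1{|H|}\sum_{h\in H}f(x+h)(-1)^{\langle t,h\rangle}$. The coset $x+H$ is $\epsilon$-uniform for $f$ if $|\widehat f_{x+H}(t)|\le\epsilon$ for every $t\notin H^\perp$, where $H^\perp=\{y\in G:\langle y,h\rangle=0\ \forall h\in H\}$. $H$ is $\epsilon$-regular for $f$ if all but at most $\epsilon|G|$ points $x\in G$ lie in $\epsilon$-uniform cosets of $H$. $\operatorname{reg}_\epsilon(f)=\min\{2^{\operatorname{codim}H}:H\le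 G\text{ is }\epsilon\text{-regular for }f\}$. HLM construction. Fix $0<\epsilon\le1/256$ and $s=\lfloor1/(16\epsilon)\rfloor\ge16$. Define $d_1=1$, $D_0=0$, $D_i=\sum_{j\le i}d_j$, and $d_{i+1}=2^{D_i}$ for $i=1,2$, $d_{i+1}=2^{D_i-3}$ for $i\ge3$ (so $d_1,\dots,d_4=1,2,8,2^8$). Put $n=D_s$ and $G=\mathbb F_2^{\,n}$. Split coordinates into $s$ consecutive blocks, $x=(x^1,\dots,x^s)$ with $x^i\in\mathbb F_2^{d_i}$, and write $x^{<i}=(x^1,\dots,x^{i-1})\in\mathbb F_2^{D_{i-1}}$. An admissible HLM realization is a family of maps $\xi_i:\mathbb F_2^{D_{i-1}}\to\mathbb F_2^{d_i}$ ($1\le i\le s$), with images $\Xi_i=\xi_i(\mathbb F_2^{D_{i-1}})$, such that for every $i$: $\xi_i(u)\ne0$ for all $u$; $\Xi_i$ spans $\mathbb F_2^{d_i}$; $\xi_i$ is injective; for $i\le3$ the image $\Xi_i$ is a basis of $\mathbb F_2^{d_i}$; and for $i>3$ (where $|\Xi_i|=2^{D_{i-1}}=8d_i$) every subset of $\Xi_i$ containing at least $3|\Xi_i|/4$ vectors spans $\mathbb F_2^{d_i}$. The level sets are $A_i=\{x\in G:\langle x^i,\xi_i(x^{<i})\rangle=0\}$, and the averaged witness is $f=\frac1s\sum_{i=1}^s\mathbf 1_{A_i}$. *)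

(* Defs.v *)
From HB Require Import structures.
From mathcomp Require Import all_boot all_order all_algebra.
From mathcomp Require Import reals.

Set Implicit Arguments.
Unset Strict Implicit.
Unset Printing Implicit Defensive.

Import Order.TTheory GRing.Theory Num.Theory.

Local Open Scope ring_scope.

Fixpoint twr (r : nat) : nat := (if r is r'.+1 then 2 ^ twr r' else 1)%N.

Definition dotp (m : nat) (u v : 'rV['F_2]_m) : 'F_2 := \sum_(j < m) u 0 j * v 0 j.

Section Ladders.
Variable G : finZmodType.
Implicit Types A B C : {set G}.

Definition symdiff A B : {set G} := (A :\: B) :|: (B :\: A).

Definition ladder A (k : nat) (a b : {ffun 'I_k -> G}) : bool :=
  [forall p, forall q, (a p + b q \in A) == (p <= q)%N].

Definition has_ladder A (k : nat) : bool :=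
  [exists a : {ffun 'I_k -> G}, exists b : {ffun 'I_k -> G}, ladder A a b].

Definition stable_sets (k : nat) : {set {set G}} := [set A | ~~ has_ladder A k].

Lemma has_ladder_leq A k : has_ladder A k -> (k <= #|G|)%N.
Proof.
case/existsP=> a /existsP[b /forallP lab].
have inj_a : injective a.
  move=> p p' eq_a; apply: val_inj; apply/eqP; rewrite eqn_leq; apply/andP.
  split.
    by have /eqP <- := forallP (lab p) p'; rewrite eq_a (eqP (forallP (lab p') p')).
  by have /eqP <- := forallP (lab p') p; rewrite -eq_a (eqP (forallP (lab p) p)).
by have := leq_card a inj_a; rewrite card_ord.
Qed.

Lemma has_ladder0 A : has_ladder A 0.
Proof.
by apply/existsP; exists [ffun => 0]; apply/existsP; exists [ffun => 0];
  apply/forallP=> -[].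
Qed.

(* By [has_ladder_leq], bounding the range by [#|G|] loses no ladder length. *)
Definition ldr A : nat := (\max_(k < #|G|.+1 | has_ladder A k) k)%N.

Lemma ldrP A : has_ladder A (ldr A) /\ forall k, has_ladder A k -> (k <= ldr A)%N.
Proof.
split=> [|k lk]; last first.
  have ltk : (k < #|G|.+1)%N by rewrite ltnS (has_ladder_leq lk).
  by apply: (bigop.bigmax_sup (Ordinal ltk)).
rewrite /ldr; apply: (big_ind (has_ladder A)) => // [|x y hx hy]; first exact: has_ladder0.
by rewrite /maxn; case: ifP.
Qed.

Lemma stable_sets_set0 k : (0 < k)%N -> set0 \in stable_sets k.
Proof.
case: k => // k _; rewrite inE; apply/existsP=> -[a /existsP[b /forallP lab]].
by have := forallP (lab ord0) ord0; rewrite inE.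
Qed.

Lemma ldr_set0 : ldr set0 = 0%N.
Proof.
have [l0 _] := ldrP set0; case: (posnP (ldr set0)) => // /stable_sets_set0.
by rewrite inE l0.
Qed.

(* A minimum over a nonempty family as soon as [0 <= eta]: see [ldr_starP]. *)
Definition ldr_star (R : realType) (eta : R) A : nat :=
  ldr (symdiff A
    [arg min_(B < set0 | (#|B|%:R <= eta * #|G|%:R)%R) ldr (symdiff A B)]%N).

Lemma ldr_starP (R : realType) (eta : R) A : 0 <= eta ->
  (exists2 B : {set G}, #|B|%:R <= eta * #|G|%:R &
     ldr_star eta A = ldr (symdiff A B)) /\
  (forall B : {set G}, #|B|%:R <= eta * #|G|%:R ->
     (ldr_star eta A <= ldr (symdiff A B))%N).
Proof.
move=> eta0; rewrite /ldr_star; case: arg_minnP => [|B leB minB].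
  by rewrite cards0 mulr_ge0.
by split=> //; exists B.
Qed.

(* The seed [1] bounds every term, so this is the minimum over [F] whenever
   [F] is nonempty (see [distP]). *)
Definition dist (R : realType) A (F : {set {set G}}) : R :=
  \big[Num.min/1]_(C in F) (#|symdiff A C|%:R / #|G|%:R).

Lemma distP (R : realType) A (F : {set {set G}}) : F != set0 ->
  (exists2 C, C \in F & dist R A F = #|symdiff A C|%:R / #|G|%:R) /\
  (forall C, C \in F -> dist R A F <= #|symdiff A C|%:R / #|G|%:R).
Proof.
case/set0Pn=> C0 C0F.
have G0 : (0 : R) < #|G|%:R by rewrite ltr0n; apply/card_gt0P; exists 0.
have le1 C : #|symdiff A C|%:R / #|G|%:R <= 1 :> R.
  by rewrite ler_pdivrMr // mul1r ler_nat max_card.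
have ledist C : C \in F -> dist R A F <= #|symdiff A C|%:R / #|G|%:R.
  by move=> CF; rewrite /dist (bigD1 C) //= ge_min lexx.
split=> //.
have : dist R A F = 1 \/
    exists2 C, C \in F & dist R A F = #|symdiff A C|%:R / #|G|%:R.
  rewrite /dist; apply: (big_ind (fun x => x = 1 \/
    exists2 C, C \in F & x = #|symdiff A C|%:R / #|G|%:R)).
  - by left.
  - by move=> x y hx hy; rewrite /Order.min; case: ifP.
  - by move=> C CF; right; exists C.
case=> // d1; exists C0 => //; apply/le_anti.
by rewrite ledist // d1 le1.
Qed.

End Ladders.

Section FinVspace.
Import VectorInternalTheory.
Variables (K : finFieldType) (vT : vectType K).

HB.instance Definition _ := [Countable of {vspace vT} by <:].
HB.instance Definition _ := [Finite of {vspace vT} by <:].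

End FinVspace.

Section Regularity.
Variables (R : realType) (m : nat).
Local Notation G := 'rV['F_2]_m.
Implicit Types (H : {vspace G}) (f : G -> R) (x t : G) (eps : R).

Definition codim H : nat := (\dim {:G} - \dim H)%N.

Definition perp H : {set G} := [set y | [forall h in H, dotp y h == 0]].

Definition coset_fourier f H x t : R :=
  #|H|%:R^-1 * \sum_(h in H) f (x + h) * (-1) ^+ nat_of_ord (dotp t h).

Definition uniform_coset eps f H x : bool :=
  [forall t, (t \notin perp H) ==> (`|coset_fourier f H x t| <= eps)].

Definition regular eps f H : bool :=
  #|[set x | ~~ uniform_coset eps f H x]|%:R <= eps * #|{: G}|%:R.

Lemma regular0 eps f : 0 <= eps -> regular eps f 0%VS.
Proof.
move=> eps0; rewrite /regular (_ : [set x | _] = set0) ?cards0 ?mulr_ge0 //.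
apply/setP=> x; rewrite !inE; apply/negbF/forallP=> t; apply/implyP; rewrite inE.
case/negP; apply/forall_inP=> h; rewrite memv0 => /eqP->.
by rewrite /dotp big1 // => j _; rewrite mxE mulr0.
Qed.

(* A minimum over a nonempty family as soon as [0 <= eps]: see [regP]. *)
Definition reg eps f : nat :=
  (2 ^ codim [arg min_(H < 0%VS | regular eps f H) 2 ^ codim H])%N.

Lemma regP eps f : 0 <= eps ->
  (exists2 H, regular eps f H & reg eps f = 2 ^ codim H)%N /\
  (forall H, regular eps f H -> (reg eps f <= 2 ^ codim H)%N).
Proof.
move=> eps0; rewrite /reg; case: arg_minnP => [|H regH minH].
  exact: regular0.
by split=> //; exists H.
Qed.

End Regularity.

Definition hlm_step (i D : nat) : nat :=
  match i with 0 => 1 | 1 | 2 => 2 ^ D | _ => 2 ^ (D - 3) end%N.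

Fixpoint hlm_D (i : nat) : nat :=
  (if i is j.+1 then hlm_D j + hlm_step j (hlm_D j) else 0)%N.

(* Block sizes are numbered from 1; [hlm_d 0 = 0] is a dummy value. *)
Definition hlm_d (i : nat) : nat :=
  (if i is j.+1 then hlm_step j (hlm_D j) else 0)%N.

Lemma hlm_DE i : hlm_D i = (\sum_(1 <= j < i.+1) hlm_d j)%N.
Proof.
by elim: i => [|i IHi]; [rewrite big_geq | rewrite big_nat_recr //= -IHi].
Qed.

Lemma hlm_d1 : hlm_d 1 = 1%N. Proof. by []. Qed.

Lemma hlm_dS i : (0 < i)%N ->
  hlm_d i.+1 = (if i <= 2 then 2 ^ hlm_D i else 2 ^ (hlm_D i - 3))%N.
Proof. by case: i => [|[|[|i]]]. Qed.

Lemma leq_hlm_D i j : (i <= j)%N -> (hlm_D i <= hlm_D j)%N.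
Proof.
move=> /subnKC <-; elim: (j - i)%N => [|k IHk]; first by rewrite addn0.
by rewrite addnS /= (leq_trans IHk) // leq_addr.
Qed.

Section HLM.
Variable s : nat.
Local Notation G := 'rV['F_2]_(hlm_D s).

(* An index [i : 'I_s] stands for block number [i.+1], whose coordinates are
   those from [hlm_D i] to [hlm_D i.+1 = hlm_D i + hlm_d i.+1] (excluded). *)
Definition hlm_maps : Type :=
  forall i : 'I_s, 'rV['F_2]_(hlm_D i) -> 'rV['F_2]_(hlm_d i.+1).

Definition hlm_block (i : 'I_s) (x : G) : 'rV['F_2]_(hlm_d i.+1) :=
  \row_j x 0 (widen_ord (leq_hlm_D (ltn_ord i)) (rshift (hlm_D i) j)).

Definition hlm_prefix (i : 'I_s) (x : G) : 'rV['F_2]_(hlm_D i) :=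
  \row_j x 0 (widen_ord (leq_hlm_D (ltnW (ltn_ord i))) j).

Variable xi : hlm_maps.

Definition hlm_image (i : 'I_s) : {set 'rV['F_2]_(hlm_d i.+1)} :=
  [set xi u | u : 'rV['F_2]_(hlm_D i)].

Definition hlm_admissible : Prop := forall i : 'I_s,
  [/\ forall u : 'rV['F_2]_(hlm_D i), xi u != 0,
      <<enum (hlm_image i)>>%VS = fullv,
      injective (@xi i),
      (i.+1 <= 3)%N -> basis_of fullv (enum (hlm_image i))
    & (3 < i.+1)%N -> forall Y : {set 'rV['F_2]_(hlm_d i.+1)},
        Y \subset hlm_image i -> (3 * #|hlm_image i| <= 4 * #|Y|)%N ->
        <<enum Y>>%VS = fullv].

Definition hlm_level (i : 'I_s) : {set G} :=
  [set x | dotp (hlm_block i x) (xi (hlm_prefix i x)) == 0].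

Definition hlm_witness (R : realType) (x : G) : R :=
  s%:R^-1 * \sum_(i < s) (x \in hlm_level i)%:R.

Lemma hlm_witness01 (R : realType) (x : G) : 0 <= hlm_witness R x <= 1.
Proof.
rewrite /hlm_witness mulr_ge0 ?invr_ge0 ?sumr_ge0 //=.
have [s0|s_gt0] := posnP s.
  by rewrite [X in X%:R^-1]s0 invr0 mul0r ler01.
rewrite ler_pdivrMl ?ltr0n // mulr1 -[X in _ <= X%:R]card_ord -sum1_card natr_sum.
by apply: ler_sum => i _; case: (x \in _).
Qed.

End HLM.

Arguments hlm_witness {s} xi {R} x.
Arguments dist {G R} A F.
Arguments stable_sets : clear implicits.

(* Main.v *)
Require Import Defs.
From HB Require Import structures.
From mathcomp Require Import all_boot all_order all_algebra.
From mathcomp Require Import reals.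
From mathcomp Require Import fingroup perm.
From mathcomp Require boolp.
From mathcomp Require Import zify ring lra.

(* Write [x = (u, y)] with [y] the last block.  Above the points [u] where
   exactly [c0] of the first [s - 1] levels contain [x], the superlevel set is
   the hyperplane orthogonal to [xi_s u].  The levels are pairwise uncorrelated,
   so by Chebyshev some value [c0] has a fibre of at least [m] points [u], and
   permuting the arguments of [xi_s] makes their images linearly independent.
   The traces of the superlevel set on these [m] points are then all the subsets
   equally often; after a perturbation by a set of density [eps] they are still
   too numerous for VC-dimension below [m / 16], and a shattered set of size
   [m / 16] contains a ladder.  An admissible realization exists by random
   coding.  For the regularity claim, on the cosets of a nonzero subspace the
   first level that is not constant is a character, and the sum of the later
   levels is uncorrelated with it, so the corresponding Fourier coefficient is
   not small on average. *)

Set Implicit Arguments.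
Unset Strict Implicit.
Unset Printing Implicit Defensive.

Import Order.TTheory GRing.Theory Num.Theory.

Local Open Scope ring_scope.

(** * Shattering and perturbation *)

Lemma subset_card_exists (I : finType) (A : {set I}) (k : nat) :
  (k <= #|A|)%N -> exists2 B : {set I}, B \subset A & #|B| = k.
Proof.
move=> lek; exists [set x in take k (enum A)].
  by apply/subsetP=> x; rewrite inE => /mem_take; rewrite mem_enum.
rewrite cardsE (card_uniqP _) ?take_uniq ?enum_uniq //.
by rewrite size_takel // -cardE.
Qed.

Section Shattering.
Variable I : finType.
Implicit Types (F : {set {set I}}) (A K T : {set I}).

Definition shatters F K : bool :=
  [forall A : {set I}, (A \subset K) ==> [exists C in F, C :&: K == A]].

Lemma shattersP F K :
  reflect (forall A, A \subset K -> exists2 C, C \in F & C :&: K = A)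
          (shatters F K).
Proof.
apply: (iffP forallP) => [sh A sAK | sh A].
  by have /exists_inP[C CF /eqP eqA] := implyP (sh A) sAK; exists C.
by apply/implyP=> /sh[C CF eqA]; apply/exists_inP; exists C => //; apply/eqP.
Qed.

Lemma shatters_sub F K K' : K' \subset K -> shatters F K -> shatters F K'.
Proof.
move=> sK'K /shattersP sh; apply/shattersP=> A sAK'.
have [C CF eqA] := sh A (subset_trans sAK' sK'K); exists C => //.
have -> : C :&: K' = (C :&: K) :&: K' by rewrite -setIA (setIidPr sK'K).
by rewrite eqA; apply/setIidPl.
Qed.

Lemma shattersS F F' K : F \subset F' -> shatters F K -> shatters F' K.
Proof.
move=> sFF' /shattersP sh; apply/shattersP=> A /sh[C CF eqA].
by exists C => //; apply: (subsetP sFF').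
Qed.

Lemma shatters_cover F K T :
  F \subset powerset T -> shatters F K -> K \subset T.
Proof.
move=> sFT /shattersP /(_ K (subxx _))[C CF eqK].
by rewrite -eqK subIset //; have := subsetP sFT _ CF; rewrite inE => ->.
Qed.

(* Pajor's strengthening of the Sauer--Shelah lemma: it needs no binomial
   sum, so the induction on the ground set [T] goes through directly. *)
Lemma card_shattered F : (#|F| <= #|[set K | shatters F K]|)%N.
Proof.
have: F \subset powerset [set: I] by apply/subsetP=> A _; rewrite inE subsetT.
move: [set: I] => T; elim: {T}#|T| {-2}T (leqnn #|T|) F => [|n IHn] T leT F sFT.
  have T0 : T = set0 by apply/eqP; rewrite -cards_eq0 -leqn0.
  rewrite T0 powerset0 in sFT.
  have [->|F0] := eqVneq F set0; first by rewrite cards0.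
  have [-> _] : F = [set set0] /\ F != set0.
    by split=> //; apply/eqP; rewrite eqEsubset sFT sub1set;
      case/set0Pn: F0 => A AF; have:= subsetP sFT _ AF; rewrite inE => /eqP <-.
  rewrite cards1; apply/card_gt0P; exists set0; rewrite inE.
  by apply/shattersP=> A; rewrite subset0 => /eqP->; exists set0; rewrite ?inE ?setI0.
have [T0|[x xT]] := set_0Vmem T.
  by apply: (IHn T) => //; rewrite T0 cards0.
have cardT : (#|T :\ x| <= n)%N by have := cardsD1 x T; rewrite xT; lia.
(* Both halves live on [T :\ x], where the induction hypothesis applies. *)
pose F0 := [set A in F | x \notin A].
pose F1 := [set A :\ x | A in F & x \in A].
have sF0 : F0 \subset powerset (T :\ x).
  apply/subsetP=> A; rewrite !inE subsetD1 => /andP[AF ->].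
  by rewrite andbT; have:= subsetP sFT _ AF; rewrite inE.
have sF1 : F1 \subset powerset (T :\ x).
  apply/subsetP=> _ /imsetP[A + ->]; rewrite inE => /andP[AF xA].
  by rewrite inE setSD //; have:= subsetP sFT _ AF; rewrite inE.
have cardF : (#|F| <= #|F0| + #|F1|)%N.
  have -> : #|F1| = #|[set A in F | x \in A]|.
    rewrite card_in_imset; last first.
      move=> A B; rewrite !inE => /andP[_ xA] /andP[_ xB] eqAB.
      by rewrite -(setD1K xA) -(setD1K xB) eqAB.
    by apply: eq_card => A; rewrite !inE.
  rewrite -cardsUI; apply: leq_trans (leq_addr _ _); apply: subset_leq_card.
  by apply/subsetP=> A AF; rewrite !inE AF /=; case: (x \in A).
apply: leq_trans cardF _.
have := leq_add (IHn _ cardT _ sF0) (IHn _ cardT _ sF1) => /leq_trans; apply.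
rewrite -cardsUI.
set S0 := [set K | shatters F0 K]; set S1 := [set K | shatters F1 K].
have mem0 K : (K \in S0) = shatters F0 K by rewrite inE.
have mem1 K : (K \in S1) = shatters F1 K by rewrite inE.
have notx K : K \in S0 :|: S1 -> x \notin K.
  by rewrite in_setU mem0 mem1 => /orP[/(shatters_cover sF0)|/(shatters_cover sF1)];
    rewrite subsetD1 => /andP[].
(* A set [K] shattered by both halves is counted twice. Its second copy is [x |: K], which [F]
   shatters because every trace on [K] occurs both with and without [x]. *)
pose S2 := [set x |: K | K in S0 :&: S1].
have -> : #|S0 :&: S1| = #|S2|.
  rewrite card_in_imset // => K K' /setIP[KS _] /setIP[KS' _] eqK.
  have xK : x \notin K by rewrite notx // in_setU KS.
  have xK' : x \notin K' by rewrite notx // in_setU KS'.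
  by rewrite -(setU1K xK) eqK setU1K.
have -> : (#|S0 :|: S1| + #|S2| = #|(S0 :|: S1) :|: S2|)%N.
  rewrite -[RHS]addn0 -cardsUI; congr (_ + _)%N; apply/eqP.
  rewrite cards_eq0 -subset0; apply/subsetP=> K /setIP[KS /imsetP[K' _ eqK]].
  by have:= notx K KS; rewrite eqK setU11.
apply: subset_leq_card; apply/subsetP=> K /setUP[/setUP[]|].
- by rewrite mem0 inE; apply: shattersS; apply/subsetP=> A; rewrite inE => /andP[].
- rewrite mem1 => sh; have xK : x \notin K by apply: notx; rewrite in_setU mem1 sh orbT.
  rewrite inE; apply/shattersP=> A /(shattersP _ _ sh)[_ /imsetP[C + ->] <-].
  rewrite inE => /andP[CF xC]; exists C => //.
  apply/setP=> y; rewrite !inE; case: eqVneq => [->|] //=.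
  by rewrite (negbTE xK) andbF.
case/imsetP=> K' /setIP[KS0 KS1 ->].
have xK' : x \notin K' by apply: notx; rewrite in_setU KS0.
move: KS0 KS1; rewrite mem0 mem1 inE => sh0 sh1; apply/shattersP=> A sA.
have sA' : A :\ x \subset K'.
  by apply/subsetP=> y /setD1P[yx /(subsetP sA)]; rewrite !inE (negbTE yx).
have [xA|xA] := boolP (x \in A).
  have [_ /imsetP[C + ->] eqA] := shattersP _ _ sh1 _ sA'.
  rewrite inE => /andP[CF xC]; exists C => //; rewrite -(setD1K xA) -eqA.
  by apply/setP=> y; rewrite !inE; case: eqVneq => [->|] //=; rewrite xC.
have [C] := shattersP _ _ sh0 _ sA'; rewrite inE => /andP[CF xC] eqA.
have eqAx : A = A :\ x.
  by apply/setP=> y; rewrite !inE; case: eqVneq => [->|] //; rewrite (negbTE xA).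
exists C => //; rewrite [RHS]eqAx -eqA.
apply/setP=> y; rewrite !inE; case: eqVneq => [->|] //=.
by rewrite (negbTE xC).
Qed.

(** Exponential weights: give each [A] inside [T] the weight [8 ^ (#|T| - #|A|)]. By distributivity
    the total weight is [(1 + 8) ^ #|T|], while a set of size at most [r] weighs at least
    [8 ^ (#|T| - r)]. *)
Lemma card_small_subsets T r : (r <= #|T|)%N ->
  (#|[set A : {set I} | A \subset T & #|A| <= r]| * 8 ^ (#|T| - r) <= 9 ^ #|T|)%N.
Proof.
move=> ler; rewrite -sum_nat_const.
pose h A := (\prod_i if i \in A then (i \in T : nat) else if i \in T then 8 else 1)%N.
have hE A : A \subset T -> h A = (8 ^ (#|T| - #|A|))%N.
  move=> sAT; rewrite /h -(setIidPr sAT) -cardsD (setIidPr sAT) -prod_nat_const.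
  rewrite [RHS]big_mkcond; apply: eq_bigr => i _; rewrite !inE.
  by case: (boolP (i \in A)) => [/(subsetP sAT)-> //|] /=.
apply: (@leq_trans (\sum_(A : {set I}) h A)).
  rewrite big_mkcond; apply: leq_sum => A _; rewrite inE.
  by case: ifP => // /andP[sAT leA]; rewrite hE // leq_exp2l //; lia.
rewrite -(@bigA_distr _ 0%N 1%N muln addn) /= -prod_nat_const [X in (_ <= X)%N]big_mkcond.
by apply/eq_leq/eq_bigr => i _; case: (i \in T).
Qed.

End Shattering.

(* The patterns [W z] restricted to [T] are uniform, and perturbing a pattern
   by [E z] costs little on average; counting the triples below shows that the
   perturbed patterns remain too numerous to have VC-dimension below [k].  The
   constants work because [2 * 9 ^ 32 < 2 ^ 16 * 8 ^ 29]. *)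
Lemma perturbed_shatters (I Z : finType) (T : {set I}) (k : nat)
    (W E : Z -> {set I}) :
  (0 < k)%N -> #|T| = (16 * k)%N -> injective W -> #|Z| = (2 ^ #|I|)%N ->
  (forall z, E z \subset T) -> (\sum_z #|E z| <= k * #|Z|)%N ->
  exists2 K : {set I}, K \subset T & #|K| = k /\
    forall A : {set I}, A \subset K -> exists z, ((W z :\: E z) :|: (E z :\: W z)) :&: K = A.
Proof.
move=> k0 cT injW cZ sET sumE.
pose P z := ((W z :\: E z) :|: (E z :\: W z)) :&: T.
pose F := [set P z | z : Z].
have sFT : F \subset powerset T.
  by apply/subsetP=> _ /imsetP[z _ ->]; rewrite inE subsetIr.
have [/existsP[K /andP[/andP[sKT /eqP cK] sh]]|noK] :=
    boolP [exists K : {set I}, (K \subset T) && (#|K| == k) && shatters F K].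
  exists K => //; split=> // A /(shattersP _ _ sh)[_ /imsetP[z _ ->] <-].
  by exists z; rewrite /P -setIA (setIidPr sKT).
exfalso.
pose V r := [set A : {set I} | A \subset T & (#|A| <= r)%N].
have cF : (#|F| <= #|V k|)%N.
  apply: leq_trans (card_shattered F) _; apply: subset_leq_card.
  apply/subsetP=> K; rewrite !inE => sh.
  have sKT := shatters_cover sFT sh; rewrite sKT /=.
  rewrite leqNgt; apply/negP=> ltk; case/negP: noK.
  have [K' sK'K cK'] : exists2 K' : {set I}, K' \subset K & #|K'| = k.
    exact: subset_card_exists (ltnW ltk).
  apply/existsP; exists K'; rewrite (subset_trans sK'K) // cK' eqxx /=.
  exact: shatters_sub sh.
(* Markov's inequality: at least half of the [z] have a perturbation of at most twice the average
   bound [k]. *)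
pose Zg := [set z | (#|E z| <= k.*2)%N].
have cZg : (#|Z| <= 2 * #|Zg|)%N.
  have : (\sum_(z in ~: Zg) (2 * k).+1 <= k * #|Z|)%N.
    apply: leq_trans sumE; rewrite big_mkcond; apply: leq_sum => z _.
    by rewrite !inE -ltnNge; case: ifP => //; lia.
  rewrite sum_nat_const; have := cardsC Zg; nia.
have cZg' : (#|Zg| <= #|V k| * (#|V k.*2| * 2 ^ (#|I| - 16 * k)))%N.
  (* [P z] and [E z] determine [W z] inside [T], and the last component records it outside [T]. *)
  pose q z := (P z, (E z, W z :\: T)).
  have injq : injective q.
    move=> z z' [eP eE eW]; apply: injW.
    rewrite -(setID (W z) T) -(setID (W z') T) eW; congr (_ :|: _).
    apply/setP=> i; have := congr1 (fun A : {set I} => i \in A) eP.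
    by rewrite /P eE !inE; case: (i \in W z); case: (i \in W z');
      case: (i \in E z'); case: (i \in T).
  rewrite -(card_imset _ injq).
  have : [set q z | z in Zg] \subset setX F (setX (V k.*2) (powerset (~: T))).
    apply/subsetP=> _ /imsetP[z zg ->]; rewrite inE /= imset_f //= inE /=.
    by rewrite !inE sET /=; rewrite inE in zg; rewrite zg /= subDset setUCr subsetT.
  move/subset_leq_card/leq_trans; apply; rewrite !cardsX card_powerset.
  by have -> : #|~: T| = (#|I| - 16 * k)%N; [have := cardsC T; lia | rewrite leq_mul2r cF orbT].
have leT : (16 * k <= #|I|)%N by rewrite -cT max_card.
have b1 := @card_small_subsets I T k; have b2 := @card_small_subsets I T k.*2.
rewrite cT -/(V k) -/(V k.*2) in b1 b2.
have {b1} b1 : (#|V k| * 8 ^ (15 * k) <= 9 ^ (16 * k))%N.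
  by have -> : (15 * k = 16 * k - k)%N; [lia | apply: b1; lia].
have {b2} b2 : (#|V k.*2| * 8 ^ (14 * k) <= 9 ^ (16 * k))%N.
  by have -> : (14 * k = 16 * k - k.*2)%N; [lia | apply: b2; lia].
have {cZg cZg'} : (2 ^ (16 * k) <= 2 * (#|V k| * #|V k.*2|))%N.
  rewrite -(@leq_pmul2r (2 ^ (#|I| - 16 * k))) ?expn_gt0 // -expnD subnKC //.
  rewrite -cZ; apply: leq_trans cZg _; rewrite -mulnA leq_mul2l /= -mulnA.
  exact: cZg'.
have pos e : (0 < 8 ^ e)%N by rewrite expn_gt0.
move=> le1.
have: (2 ^ (16 * k) * (8 ^ (15 * k) * 8 ^ (14 * k)) <= 2 * (9 ^ (16 * k) * 9 ^ (16 * k)))%N.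
  apply: leq_trans (leq_mul le1 (leqnn _)) _.
  by rewrite -mulnA leq_mul2l mulnACA leq_mul.
rewrite -!expnD -!mulnDl expnM -!(expnM _ _ k) !expnM -expnMn.
apply/negP; rewrite -ltnNge.
apply: (@leq_ltn_trans (2 ^ k * (9 ^ (16 + 16)) ^ k)).
  by rewrite leq_mul // -[leqLHS]expn1 leq_exp2l.
rewrite -expnMn (ltn_exp2r _ _ k0).
lia.
Qed.

(** * Linear algebra over F_2 and random codes *)

Section DotProduct.
Variable m : nat.
Implicit Types (u v w : 'rV['F_2]_m).

Lemma F2_cases (a : 'F_2) : a = 0 \/ a = 1.
Proof. by case: a => -[|[|//]] lt2; [left | right]; apply: val_inj. Qed.

Lemma F2_neq0 (a : 'F_2) : a != 0 -> a = 1.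
Proof. by case: (F2_cases a) => ->; rewrite ?eqxx. Qed.

Lemma F2_addrr (a : 'F_2) : a + a = 0.
Proof. by case: (F2_cases a) => ->; apply: val_inj. Qed.

Lemma rowF2_addrr u : u + u = 0.
Proof. by apply/rowP=> j; rewrite !mxE F2_addrr. Qed.

Lemma rowF2_addrK u : involutive (+%R^~ u).
Proof. by move=> v /=; rewrite -addrA rowF2_addrr addr0. Qed.

Lemma dotpDl u v w : dotp (u + v) w = dotp u w + dotp v w.
Proof. by rewrite /dotp -big_split; apply: eq_bigr => j _; rewrite mxE mulrDl. Qed.

Lemma dotpC u v : dotp u v = dotp v u.
Proof. by apply: eq_bigr => j _; rewrite mulrC. Qed.

Lemma dotpDr u v w : dotp w (u + v) = dotp w u + dotp w v.
Proof. by rewrite dotpC dotpDl !(dotpC w). Qed.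

Lemma dotp_delta k v : dotp (delta_mx 0 k) v = v 0 k.
Proof.
rewrite /dotp (bigD1 k) //= mxE !eqxx mul1r big1 ?addr0 // => j jk.
by rewrite mxE (negbTE jk) mul0r.
Qed.

Lemma dotp_suml (I : Type) (r : seq I) (P : pred I) (c : I -> 'F_2)
    (X : I -> 'rV['F_2]_m) v :
  dotp v (\sum_(i <- r | P i) c i *: X i) = \sum_(i <- r | P i) c i * dotp v (X i).
Proof.
rewrite /dotp; under [RHS]eq_bigr do rewrite mulr_sumr.
rewrite exchange_big /=; apply: eq_bigr => j _.
rewrite summxE mulr_sumr; apply: eq_bigr => i _.
by rewrite mxE mulrCA.
Qed.

Lemma row_neq0_coord u : u != 0 -> exists k, u 0 k = 1.
Proof.
move=> u0; have [/existsP[k /eqP uk]|] := boolP [exists k, u 0 k == 1].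
  by exists k.
rewrite negb_exists => /forallP no1; case/eqP: u0; apply/rowP=> k; rewrite mxE.
by case: (F2_cases (u 0 k)) (no1 k) => ->.
Qed.

Lemma span_orth0 (X : seq 'rV['F_2]_m) u :
  <<X>>%VS = fullv -> {in X, forall v, dotp u v = 0} -> u = 0.
Proof.
move=> spX orth; apply/rowP=> k; rewrite mxE -(dotp_delta k u) dotpC.
have : delta_mx 0 k \in <<in_tuple X>>%VS by rewrite /= spX memvf.
move/coord_span->; rewrite dotp_suml big1 // => i _.
by rewrite orth ?mulr0 // mem_nth.
Qed.

(** Every column of the cokernel of [A] is orthogonal to all rows of [A], hence zero. *)
Lemma orth0_row_full q (A : 'M['F_2]_(q, m)) :
  (forall u, (forall i, dotp u (row i A) = 0) -> u = 0) -> row_full A.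
Proof.
move=> orth; rewrite -cokermx_eq0; apply/eqP/matrixP=> i j.
have /rowP/(_ i) : (col j (cokermx A))^T = 0.
  apply: orth => k; have /matrixP/(_ k j) := mulmx_coker A.
  rewrite !mxE => <-; rewrite dotpC; apply: eq_bigr => l _.
  by rewrite !mxE.
by rewrite !mxE.
Qed.

Lemma orth0_span (Y : {set 'rV['F_2]_m}) :
  (forall u, {in Y, forall v, dotp u v = 0} -> u = 0) -> <<enum Y>>%VS = fullv.
Proof.
move=> orth; pose A : 'M['F_2]_(#|Y|, m) := \matrix_(i < #|Y|) enum_val i.
have rowA i : row i A = enum_val i by apply/rowP=> j; rewrite !mxE.
have fullA : row_full A.
  apply: orth0_row_full => u uA; apply: orth => v vY.
  by rewrite -(enum_rankK_in vY vY) -rowA uA.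
apply/eqP; rewrite eqEsubv subvf; apply/subvP=> v _.
have /submxP[D ->] := submx_full v fullA.
rewrite mulmx_sum_row memv_suml // => i _; rewrite memvZ // rowA memv_span //.
by rewrite mem_enum enum_valP.
Qed.

End DotProduct.

Lemma leq_exp2rW a b e : (a <= b)%N -> (a ^ e <= b ^ e)%N.
Proof. by case: e => // e; rewrite leq_exp2r. Qed.

(* Random coding: for uniformly random [w], each nonzero [y] is orthogonal to
   three quarters of the values with probability at most (2^4/3^3)^(2d), so a
   union bound over the [2^d] vectors [y] leaves an injective nonvanishing [w]. *)
Lemma random_code (U : finType) (d : nat) :
  #|U| = (8 * d)%N -> (2 <= d)%N -> (128 * d ^ 2 <= 2 ^ d)%N ->
  exists w : U -> 'rV['F_2]_d,
    [/\ injective w, forall u, w u != 0 &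
        forall y, y != 0 -> (#|[set u | dotp y (w u) == 0%R]| < 6 * d)%N].
Proof.
move=> cU d2 dN; pose V := 'rV['F_2]_d; pose N := (2 ^ d)%N.
have cV : #|V| = N by rewrite card_mx card_Fp // mul1n.
(* Chernoff weights: for [y != 0] the average of [wt y w] over [w] is [2 ^ (8 * d)], but the weight
   is at least [3 ^ (6 * d)] once [6 * d] values are orthogonal to [y]. *)
pose h (y v : V) : nat := if dotp y v == 0 then 3 else 1.
pose wt y (w : {ffun U -> V}) := (\prod_u h y (w u))%N.
have wtE y w : wt y w = (3 ^ #|[set u | dotp y (w u) == 0%R]|)%N.
  by rewrite /wt -prod_nat_const [RHS]big_mkcond; apply: eq_bigr => u _; rewrite inE.
have sumh y : y != 0 -> (\sum_v h y v = 2 * N)%N.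
  case/row_neq0_coord=> k yk.
  (* Translation by a unit vector at a coordinate where [y] is 1 flips [dotp y v], so the weights of
     [v] and its translate add up to 4. *)
  have e : (\sum_v h y v = \sum_v h y (v + delta_mx 0 k)%R)%N.
    by rewrite (reindex_inj (inv_inj (rowF2_addrK (delta_mx 0 k)))).
  apply: (@double_inj); rewrite -addnn {2}e -big_split /=.
  under eq_bigr => v _ do
    rewrite /h dotpDr [dotp y (delta_mx _ _)]dotpC dotp_delta yk.
  rewrite (eq_bigr (fun _ => 4%N)) => [|v _]; last by case: (F2_cases (dotp y v)) => ->.
  by rewrite sum_nat_const cV; lia.
have sumwt y : y != 0 -> (\sum_w wt y w = (2 * N) ^ (8 * d))%N.
  by move=> y0; rewrite /wt -(bigA_distr_bigA (fun=> h y)) /= prod_nat_const cU sumh.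
pose Bad := [set w : {ffun U -> V} |
  [exists y, (y != 0) && (6 * d <= #|[set u | dotp y (w u) == 0%R]|)%N]].
pose Inj := [set w : {ffun U -> V} in ffun_on (predC1 0) | injectiveb w].
have cBad : (#|Bad| * 3 ^ (6 * d) <= N * (2 * N) ^ (8 * d))%N.
  rewrite -sum_nat_const.
  apply: (@leq_trans (\sum_w \sum_(y | y != 0%R) wt y w)%N).
    rewrite big_mkcond; apply: leq_sum => w _; case: ifP => //.
    rewrite inE => /existsP[y /andP[y0 ley]]; rewrite (bigD1 y) //=.
    by apply: leq_trans (leq_addr _ _); rewrite wtE leq_exp2l.
  rewrite exchange_big /= (eq_bigr _ sumwt) sum_nat_const leq_mul2r.
  by rewrite -cV max_card orbT.
have cInj : (N ^ (8 * d) <= 2 * #|Inj|)%N.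
  rewrite card_inj_ffuns_on cU cardC1 cV.
  rewrite -/N in dN.
  (* Each factor of the falling factorial falls short of [N] by at most [8 * d]. At [q = 8 * d] the
     relative loss is at most [64 * d ^ 2 / N], which is at most one half. *)
  have ff q : (q <= 8 * d)%N -> (N ^ q * N <= N.-1 ^_ q * N + q * (8 * d) * N ^ q)%N.
    elim: q => [|q IHq] leq; first by rewrite !expn0 ffactn0; lia.
    have {IHq} := IHq (ltnW leq); rewrite ffactnSr expnSr => IHq.
    have l2 : (N.-1 - q + 8 * d >= N)%N by lia.
    have l3 : (N.-1 ^_ q <= N ^ q)%N.
      clear; elim: q => [|q IHq]; first by rewrite ffactn0.
      by rewrite ffactnSr expnSr leq_mul //; lia.
    move: l2 l3 IHq; move: (N.-1 - q)%N (N.-1 ^_ q) (N ^ q)%N (8 * d)%N => a b c e.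
    move=> l2 l3 IHq; have := leq_mul (leqnn (b * N)) l2.
    have := leq_mul IHq (leqnn N); have := leq_mul l3 (leqnn (N * e)).
    by nia.
  have := ff _ (leqnn _); set c := (N ^ _)%N; set b := _ ^_ _ => hb.
  have N0 : (0 < N)%N by rewrite expn_gt0.
  have h1 : (8 * d * (8 * d) * c * 2 <= c * N)%N by nia.
  by rewrite -(leq_pmul2r N0); nia.
have [w wI wB] : exists2 w, w \in Inj & w \notin Bad.
  apply/subsetPn; apply/negP=> /subset_leq_card leIB.
  have : (N ^ (8 * d) * 3 ^ (6 * d) <= 2 * N * (2 * N) ^ (8 * d))%N.
    have := leq_mul (leq_trans cInj (leq_mul (leqnn 2) leIB)) (leqnn (3 ^ (6 * d)))%N.
    by move/leq_trans; apply; rewrite -!mulnA leq_mul2l cBad orbT.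
  have -> : (2 * N * (2 * N) ^ (8 * d) = 2 * (2 ^ 9) ^ d * N ^ (8 * d))%N.
    by rewrite expnMn -expnM [(9 * d)%N]mulSn expnD -/N; ring.
  rewrite mulnC leq_pmul2r ?expn_gt0 //; apply/negP; rewrite -ltnNge expnM.
  rewrite -(subnKC d2) !expnD mulnA.
  (* This is 524288 against 531441; the comparison fails at [d = 1]. *)
  have e2 : (2 * (2 ^ 9) ^ 2 < (3 ^ 6) ^ 2)%N by lia.
  apply: (leq_trans (n := (3 ^ 6) ^ 2 * (2 ^ 9) ^ (d - 2))).
    by rewrite ltn_pmul2r ?expn_gt0.
  rewrite leq_mul2l; apply/orP; right; by apply: leq_exp2rW; lia.
exists w; move: wI; rewrite inE => /andP[/ffun_onP w0 /injectiveP injw]; split=> //.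
move=> y y0; rewrite ltnNge; apply: contra wB => ley; rewrite inE.
by apply/existsP; exists y; rewrite y0.
Qed.

(** A permutation correct on all but the last index is repaired by the transposition of
    [p (f ord_max)] and [g ord_max], which fixes the values already attained. *)
Lemma perm_interpolation (X : finType) (q : nat) (f g : 'I_q -> X) :
  injective f -> injective g -> exists p : {perm X}, forall i, p (f i) = g i.
Proof.
elim: q f g => [|q IHq] f g injf injg; first by exists 1%g => -[].
have injf' : injective (f \o lift ord_max) by move=> i j /injf/lift_inj.
have injg' : injective (g \o lift ord_max) by move=> i j /injg/lift_inj.
have [p pE] := IHq _ _ injf' injg'.
have {}pE j : p (f (lift ord_max j)) = g (lift ord_max j) := pE j.
exists (p * tperm (p (f ord_max)) (g ord_max))%g => i; rewrite permM.
case: (unliftP ord_max i) => [j|] ->; last by rewrite tpermL.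
rewrite pE tpermD //.
  by rewrite -pE (inj_eq perm_inj) (inj_eq injf) neq_lift.
by rewrite (inj_eq injg) neq_lift.
Qed.

(** * Existence of admissible realizations *)

Lemma hlm_d_small i : (i < 3)%N -> hlm_d i.+1 = (2 ^ hlm_D i)%N.
Proof. by case: i => [|[|[|]]]. Qed.

Lemma hlm_D_ge11 i : (3 <= i)%N -> (11 <= hlm_D i)%N.
Proof. exact: (leq_hlm_D (i := 3)). Qed.

Lemma hlm_d_large i : (3 <= i)%N -> hlm_d i.+1 = (2 ^ (hlm_D i - 3))%N.
Proof. by case: i => [|[|[|]]]. Qed.

Lemma hlm_d_mul8 i : (3 <= i)%N -> (2 ^ hlm_D i = 8 * hlm_d i.+1)%N.
Proof.
move=> i3; rewrite hlm_d_large // -[8%N]/(2 ^ 3)%N -expnD subnKC //.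
exact: leq_trans (hlm_D_ge11 i3).
Qed.

(** Compares the exponents of [128 * d ^ 2] and [2 ^ d] for [d = 2 ^ t]. *)
Lemma leq_square_exp2 t : (8 <= t)%N -> (2 * t + 7 <= 2 ^ t)%N.
Proof.
move=> t8; rewrite -(subnKC t8); elim: (t - 8)%N => [|q IHq]; first by lia.
by rewrite addnS expnS; move: (2 ^ _)%N IHq => N; lia.
Qed.

(** The clauses of [hlm_admissible] concern each map separately; isolating one block lets the maps
    be built and altered one at a time. *)
Definition block_admissible (i : nat)
    (f : 'rV['F_2]_(hlm_D i) -> 'rV['F_2]_(hlm_d i.+1)) : Prop :=
  let image := [set f u | u : 'rV['F_2]_(hlm_D i)] in
  [/\ forall u, f u != 0,
      <<enum image>>%VS = fullv,
      injective f,
      (i.+1 <= 3)%N -> basis_of fullv (enum image)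
    & (3 < i.+1)%N -> forall Y : {set 'rV['F_2]_(hlm_d i.+1)},
        Y \subset image -> (3 * #|image| <= 4 * #|Y|)%N ->
        <<enum Y>>%VS = fullv].

Lemma card_rowF2 q : #|{: 'rV['F_2]_q}| = (2 ^ q)%N.
Proof. by rewrite card_mx card_Fp // mul1n. Qed.

Lemma block_small_exists i : (i < 3)%N ->
  exists f : 'rV['F_2]_(hlm_D i) -> 'rV['F_2]_(hlm_d i.+1), block_admissible f.
Proof.
move=> i3; have cU : #|{: 'rV['F_2]_(hlm_D i)}| = hlm_d i.+1.
  by rewrite card_rowF2 hlm_d_small.
pose f (u : 'rV['F_2]_(hlm_D i)) : 'rV['F_2]_(hlm_d i.+1) :=
  delta_mx 0 (cast_ord cU (enum_rank u)).
have injf : injective f.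
  move=> u v /rowP /(_ (cast_ord cU (enum_rank u))); rewrite !mxE !eqxx /=.
  by case: eqP => [/cast_ord_inj/enum_rank_inj|_ /eqP] //; rewrite oner_eq0.
pose image := [set f u | u : 'rV['F_2]_(hlm_D i)].
have span_image : <<enum image>>%VS = fullv.
  apply/eqP; rewrite eqEsubv subvf; apply/subvP=> v _.
  rewrite [v]row_sum_delta memv_suml // => j _; rewrite memvZ // memv_span //.
  rewrite mem_enum; apply/imsetP; exists (enum_val (cast_ord (esym cU) j)) => //.
  by rewrite /f enum_valK cast_ordKV.
exists f; split=> //; last by rewrite ltnNge i3.
  move=> u; apply/eqP=> /rowP /(_ (cast_ord cU (enum_rank u))).
  by rewrite !mxE !eqxx => /eqP; rewrite oner_eq0.
move=> _; rewrite basisEdim span_image subvv dimvf -cardE.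
by rewrite card_imset // cU dim_matrix mul1r leqnn.
Qed.

(** The map comes from [random_code]. Three quarters of the [8 * d] values are [6 * d] of them, too
    many to be orthogonal to a common nonzero vector, so they span. *)
Lemma block_large_exists i : (3 <= i)%N ->
  exists f : 'rV['F_2]_(hlm_D i) -> 'rV['F_2]_(hlm_d i.+1), block_admissible f.
Proof.
move=> i3; have D11 := hlm_D_ge11 i3; set d := hlm_d i.+1.
have dE : d = (2 ^ (hlm_D i - 3))%N by apply: hlm_d_large.
have cU : #|{: 'rV['F_2]_(hlm_D i)}| = (8 * d)%N by rewrite card_rowF2 hlm_d_mul8.
have dN : (128 * d ^ 2 <= 2 ^ d)%N.
  rewrite -[128%N]/(2 ^ 7)%N {1}dE -expnM -expnD leq_exp2l // dE.
  by apply: leq_trans (leq_square_exp2 _) => //; lia.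
have d2 : (2 <= d)%N by rewrite dE -{1}[2%N]expn1 leq_exp2l //; lia.
have [f [injf f0 code]] := random_code cU d2 dN.
pose image := [set f u | u : 'rV['F_2]_(hlm_D i)].
have cimage : #|image| = (8 * d)%N by rewrite card_imset.
have spanY (Y : {set 'rV['F_2]_d}) : Y \subset image ->
    (3 * #|image| <= 4 * #|Y|)%N -> <<enum Y>>%VS = fullv.
  move=> sY cY; apply: orth0_span => y yY; apply/eqP/negPn/negP=> /code.
  apply/negP; rewrite -leqNgt; apply: (@leq_trans #|Y|).
    by move: cY; rewrite cimage; lia.
  rewrite -(card_imset _ injf); apply: subset_leq_card; apply/subsetP=> v vY.
  have /imsetP[u _ vE] := subsetP sY v vY.
  by rewrite vE imset_f // inE -vE yY.
exists f; split=> //; last by rewrite ltnNge i3.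
by apply: spanY => //; rewrite leq_mul2r orbT.
Qed.

Lemma hlm_admissible_exists s : exists xi : hlm_maps s, hlm_admissible xi.
Proof.
have ex i : exists f : 'rV['F_2]_(hlm_D i) -> 'rV['F_2]_(hlm_d i.+1),
    block_admissible f.
  by case: (ltnP i 3) => [/block_small_exists|/block_large_exists].
exists (fun i => projT1 (boolp.cid (ex i))) => i.
exact: projT2 (boolp.cid (ex i)).
Qed.

Lemma block_admissible_perm i (p : {perm 'rV['F_2]_(hlm_D i)})
    (f : 'rV['F_2]_(hlm_D i) -> 'rV['F_2]_(hlm_d i.+1)) :
  block_admissible f -> block_admissible (f \o p).
Proof.
rewrite /block_admissible.
have -> : [set (f \o p) u | u : 'rV['F_2]_(hlm_D i)] =
          [set f u | u : 'rV['F_2]_(hlm_D i)].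
  apply/setP=> v; apply/imsetP/imsetP=> -[u _ ->]; first by exists (p u).
  by exists ((p^-1)%g u) => //=; rewrite permKV.
case=> f0 spf injf bf Yf; split=> // [u|u v /=]; first exact: f0.
by move/injf/perm_inj.
Qed.

(** The fraction one eighth serves both regimes. The first three blocks have at most 8 arguments,
    and spanning provides one suitable [u]; in later blocks fewer than three quarters of the values
    are orthogonal to [y], since otherwise they would span. *)
Lemma block_nonorth i (f : 'rV['F_2]_(hlm_D i) -> 'rV['F_2]_(hlm_d i.+1)) y :
  block_admissible f -> y != 0 ->
  (2 ^ hlm_D i <= 8 * #|[set u | dotp y (f u) != 0%R]|)%N.
Proof.
case=> f0 spf injf _ Yf y0; set P := [set u | _].
case: (ltnP i 3) => i3.
  apply: (@leq_trans 8); first by case: i i3 {f f0 spf injf Yf y y0 P} => [|[|[|]]].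
  rewrite leq_pmulr // card_gt0; apply: contra y0 => /eqP P0; apply/eqP.
  apply: (span_orth0 spf) => v; rewrite mem_enum => /imsetP[u _ ->].
  by have := in_set0 u; rewrite -P0 inE => /negbFE/eqP.
pose Y := [set v in [set f u | u : 'rV['F_2]_(hlm_D i)] | dotp y v == 0].
have sY : Y \subset [set f u | u : 'rV['F_2]_(hlm_D i)].
  by apply/subsetP=> v; rewrite inE => /andP[].
have cY : #|Y| = #|~: P|.
  rewrite -(card_imset _ injf); apply: eq_card => v; rewrite inE.
  apply/andP/imsetP => [[/imsetP[u _ ->] yu]|[u uP ->]].
    by exists u => //; rewrite !inE negbK.
  by rewrite imset_f //; move: uP; rewrite !inE negbK.
have := cardsC P; rewrite card_rowF2 -cY => cP.
case: (leqP (3 * 2 ^ hlm_D i) (4 * #|Y|)) => [leY|]; last by lia.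
case/eqP: y0; apply: (span_orth0 (Yf i3 Y sY _)) => [|v].
  by rewrite card_imset // card_rowF2.
by rewrite mem_enum inE => /andP[_ /eqP].
Qed.

(** * Level signs *)

Section Signs.
Variable R : numFieldType.

Definition sgn2 (a : 'F_2) : R := (-1) ^+ nat_of_ord a.

Lemma sgn2_0 : sgn2 0 = 1. Proof. exact: expr0. Qed.

Lemma sgn2_1 : sgn2 1 = -1. Proof. exact: expr1. Qed.

Lemma sgn2D a b : sgn2 (a + b) = sgn2 a * sgn2 b.
Proof.
by case: (F2_cases a) (F2_cases b) => -> [] ->;
  rewrite ?F2_addrr ?add0r ?addr0 ?sgn2_0 ?sgn2_1 ?mulrNN ?mul1r ?mulr1.
Qed.

Lemma sgn2_sqr a : sgn2 a * sgn2 a = 1.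
Proof. by rewrite -sgn2D F2_addrr sgn2_0. Qed.

Lemma sgn2_abs a : `|sgn2 a| = 1.
Proof. by rewrite /sgn2 normrX normrN1 expr1n. Qed.

Lemma sgn2_indicator a : (a == 0)%:R = (1 + sgn2 a) / 2%:R :> R.
Proof.
case: (F2_cases a) => ->; rewrite ?eqxx ?oner_eq0 ?sgn2_0 ?sgn2_1.
  by rewrite -mulr2n divff // pnatr_eq0.
by rewrite subrr mul0r.
Qed.

Lemma sum_sign_reversing (T : finType) (P : pred T) (p : T -> T) (F : T -> R) :
  involutive p -> (forall x, P (p x) = P x) -> (forall x, P x -> F (p x) = - F x) ->
  \sum_(x | P x) F x = 0.
Proof.
move=> pK Pp Fp; have e : \sum_(x | P x) F x = - \sum_(x | P x) F x.
  rewrite {1}(reindex_inj (inv_inj pK)) -sumrN (eq_bigl _ _ Pp).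
  by apply: eq_bigr => x Px; rewrite Fp.
by apply/eqP; rewrite -eqNr -e.
Qed.

End Signs.

Section Blocks.
Variable s : nat.
Local Notation G := 'rV['F_2]_(hlm_D s).
Implicit Types (i j : 'I_s) (x y h : G).

Definition block_coord i (k : 'I_(hlm_d i.+1)) : 'I_(hlm_D s) :=
  widen_ord (leq_hlm_D (ltn_ord i)) (rshift (hlm_D i) k).

Lemma block_coord_inj i : injective (block_coord (i := i)).
Proof.
move=> k l /(congr1 val) /= /eqP; rewrite eqn_add2l => /eqP ekl.
exact: val_inj.
Qed.

Lemma block_coordP i (c : 'I_(hlm_D s)) :
  (hlm_D i <= c)%N -> (c < hlm_D i.+1)%N -> exists k, c = block_coord (i := i) k.
Proof.
move=> lec ltc; have ltk : (c - hlm_D i < hlm_d i.+1)%N by rewrite ltn_subLR.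
by exists (Ordinal ltk); apply: val_inj; rewrite /= subnKC.
Qed.

Lemma hlm_prefixP i x y :
  hlm_prefix i x = hlm_prefix i y <->
  forall c : 'I_(hlm_D s), (c < hlm_D i)%N -> x 0 c = y 0 c.
Proof.
split=> [/rowP exy c ltc | exy]; last by apply/rowP=> k; rewrite !mxE exy //=.
have := exy (Ordinal ltc); rewrite !mxE.
by congr (x 0 _ = y 0 _); apply: val_inj.
Qed.

Lemma hlm_prefix_lt i j x y : (i < j)%N -> hlm_prefix j x = hlm_prefix j y ->
  hlm_prefix i x = hlm_prefix i y /\ hlm_block i x = hlm_block i y.
Proof.
move=> ij /hlm_prefixP exy; have leD := leq_hlm_D ij; split.
  apply/hlm_prefixP=> c ltc; apply: exy; apply: leq_trans ltc _.
  exact: leq_trans (leq_hlm_D (leqnSn i)) leD.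
apply/rowP=> k; rewrite !mxE; apply: exy; apply: leq_trans leD => /=.
by rewrite ltn_add2l.
Qed.

Lemma hlm_prefixD i x y : hlm_prefix i (x + y) = hlm_prefix i x + hlm_prefix i y.
Proof. by apply/rowP=> k; rewrite !mxE. Qed.

Lemma hlm_blockD i x y : hlm_block i (x + y) = hlm_block i x + hlm_block i y.
Proof. by apply/rowP=> k; rewrite !mxE. Qed.

Definition block_embed i (v : 'rV['F_2]_(hlm_d i.+1)) : G :=
  \sum_k v 0 k *: delta_mx 0 (block_coord k).

Lemma dotp_block_embed i (v : 'rV['F_2]_(hlm_d i.+1)) x :
  dotp (block_embed v) x = dotp (hlm_block i x) v.
Proof.
rewrite dotpC /block_embed dotp_suml; apply: eq_bigr => k _.
by rewrite dotpC dotp_delta mxE mulrC.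
Qed.

Lemma block_embed_low i (v : 'rV['F_2]_(hlm_d i.+1)) (c : 'I_(hlm_D s)) :
  (c < hlm_D i)%N -> block_embed v 0 c = 0.
Proof.
move=> ltc; rewrite /block_embed summxE big1 // => k _; rewrite !mxE eqxx /=.
case: eqP => [ec|_]; last by rewrite mulr0.
by move: ltc; rewrite ec /= ltnNge leq_addr.
Qed.

Lemma hlm_prefix_embed i (v : 'rV['F_2]_(hlm_d i.+1)) :
  hlm_prefix i (block_embed v) = 0.
Proof. by apply/rowP=> k; rewrite !mxE block_embed_low /=. Qed.

Lemma hlm_block_embed i (v : 'rV['F_2]_(hlm_d i.+1)) :
  hlm_block i (block_embed v) = v.
Proof.
apply/rowP=> k; rewrite mxE -/(block_coord k) /block_embed summxE (bigD1 k) //=.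
rewrite !mxE !eqxx mulr1 big1 ?addr0 // => l lk.
by rewrite !mxE eqxx (inj_eq (@block_coord_inj i)) eq_sym (negbTE lk) mulr0.
Qed.

Variables (xi : hlm_maps s) (R : numFieldType).

Definition level_phase j x : 'F_2 := dotp (hlm_block j x) (xi (hlm_prefix j x)).

Definition level_sign j x : R := sgn2 R (level_phase j x).

Lemma level_signE j x : (x \in hlm_level xi j)%:R = (1 + level_sign j x) / 2%:R :> R.
Proof. by rewrite inE -sgn2_indicator. Qed.

(* Adding to block [j] a vector not orthogonal to [xi_j] flips the sign of
   level [j] without touching anything that depends on earlier blocks only. *)
Lemma level_sign_orth j h (P : pred G) (F : G -> R) :
  (forall u, xi (i := j) u != 0) ->
  (forall x y, hlm_prefix j x = hlm_prefix j y -> P x = P y /\ F x = F y) ->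
  \sum_(x | P x) F x * level_sign j (x + h) = 0.
Proof.
move=> xi0 Fprefix.
(* The default [0] never occurs, as [xi] does not vanish. Since [e] reads only the prefix of
   [x + h], which [p] preserves, [p] is an involution. *)
pose e x : 'rV['F_2]_(hlm_d j.+1) :=
  oapp (fun k => delta_mx 0 k) 0 [pick k | xi (hlm_prefix j (x + h)) 0 k == 1].
have eP x : dotp (e x) (xi (hlm_prefix j (x + h))) = 1.
  rewrite /e; case: pickP => [l /eqP xil|no]; first by rewrite dotp_delta.
  by have [l xil] := row_neq0_coord (xi0 (hlm_prefix j (x + h)));
    have := no l; rewrite xil eqxx.
pose p x := x + block_embed (e x).
have prefix_p x : hlm_prefix j (p x) = hlm_prefix j x.
  by rewrite hlm_prefixD hlm_prefix_embed addr0.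
have prefix_ph x : hlm_prefix j (p x + h) = hlm_prefix j (x + h).
  by rewrite [LHS]hlm_prefixD prefix_p -hlm_prefixD.
have e_p x : e (p x) = e x by rewrite /e prefix_ph.
apply: (@sum_sign_reversing _ _ _ p) => [x|x|x _].
- by rewrite /p e_p -addrA rowF2_addrr addr0.
- by have [] := Fprefix _ _ (prefix_p x).
have [_ ->] := Fprefix _ _ (prefix_p x); rewrite -mulrN; congr (_ * _).
rewrite /level_sign /level_phase prefix_ph /p addrAC.
rewrite hlm_blockD dotpDl hlm_block_embed eP sgn2D.
by rewrite sgn2_1 mulrN1.
Qed.

End Blocks.

(** * Regularity *)

Section PrefixCount.
Variable s : nat.
Local Notation G := 'rV['F_2]_(hlm_D s).
Implicit Types (i : 'I_s) (x : G).

Definition prefix_embed i (u : 'rV['F_2]_(hlm_D i)) : G :=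
  \sum_k u 0 k *: delta_mx 0 (widen_ord (leq_hlm_D (ltnW (ltn_ord i))) k).

Lemma prefix_embedK i : cancel (prefix_embed (i := i)) (hlm_prefix i).
Proof.
move=> u; apply/rowP=> k; rewrite mxE /prefix_embed summxE (bigD1 k) //=.
rewrite !mxE !eqxx mulr1 big1 ?addr0 // => l lk.
rewrite !mxE eqxx /= -val_eqE /=; case: eqP => [ekl|_]; last by rewrite mulr0.
by case/eqP: lk; apply: val_inj.
Qed.

(** All prefixes have equally large fibres: overwriting the prefix of [x] by [u], while remembering
    the old prefix, is injective in [(u, x)]. *)
Lemma card_prefix_preim i (A : {set 'rV['F_2]_(hlm_D i)}) :
  (#|A| * 2 ^ hlm_D s <= #|[set x : G | hlm_prefix i x \in A]| * 2 ^ hlm_D i)%N.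
Proof.
pose q (ux : 'rV['F_2]_(hlm_D i) * G) :=
  (ux.2 + prefix_embed (ux.1 - hlm_prefix i ux.2), hlm_prefix i ux.2).
have qE u x : hlm_prefix i (q (u, x)).1 = u.
  by rewrite hlm_prefixD prefix_embedK /= addrCA subrr addr0.
have injq : injective q.
  move=> [u x] [v y] eq_q; have euv : u = v by rewrite -(qE u x) eq_q qE.
  have e2 : hlm_prefix i x = hlm_prefix i y by case: eq_q.
  by case: eq_q => + _; rewrite /= -euv e2 => /addIr ->.
rewrite -!card_rowF2 -!cardsT -!cardsX -(card_imset _ injq); apply: subset_leq_card.
by apply/subsetP=> _ /imsetP[[u x] + ->]; rewrite !in_setX !inE qE andbT.
Qed.

End PrefixCount.

Lemma sum_sgn2_perp (R : realType) m (H : {vspace 'rV['F_2]_m}) t :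
  t \notin perp H -> \sum_(h in H) sgn2 R (dotp t h) = 0.
Proof.
rewrite inE negb_forall => /existsP[h0]; rewrite negb_imply => /andP[h0H th0].
apply: (@sum_sign_reversing _ _ _ (+%R^~ h0)) => [|h|h hH].
- exact: rowF2_addrK.
- by rewrite rpredDr.
by rewrite dotpDr sgn2D (F2_neq0 th0) sgn2_1 mulrN1.
Qed.

Lemma hlm_D_block s c : (c < hlm_D s)%N ->
  exists i : 'I_s, (hlm_D i <= c < hlm_D i.+1)%N.
Proof.
elim: s => // s IHs ltc; case: (ltnP c (hlm_D s)) => [/IHs[i ic]|lec].
  by exists (widen_ord (leqnSn s) i).
by exists ord_max; rewrite /= lec.
Qed.

Section Regularity.
Variables (R : realType) (s : nat) (eps : R) (xi : hlm_maps s).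
Local Notation G := 'rV['F_2]_(hlm_D s).
Hypotheses (s_gt0 : (0 < s)%N) (admissible_xi : hlm_admissible xi).
Hypotheses (eps_gt0 : 0 < eps) (eps_le : 16%:R * s%:R * eps <= 1).

Let xi_neq0 (j : 'I_s) u : xi (i := j) u != 0.
Proof. by case: (admissible_xi j). Qed.

(* Block [i] is the first one that [H] sees: on cosets of [H] the levels below
   [i] are constant, level [i] is a character, and the levels above [i]
   contribute nothing to the averaged [i]-th coefficient, by
   [level_sign_orth].  So that coefficient cannot be small on average. *)
Lemma not_regular (H : {vspace G}) : H != 0%VS -> ~~ regular eps (hlm_witness xi) H.
Proof.
move=> H0; apply/negP=> regH.
have [i [h0 h0H [H_prefix y0]]] : exists i : 'I_s, exists2 h0, h0 \in H &
    (forall h, h \in H -> hlm_prefix i h = 0) /\ hlm_block i h0 != 0.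
  pose nz (c : 'I_(hlm_D s)) := [exists h : G, (h \in H) && (h 0 c != 0)].
  have [c0 nzc0] : exists c, nz c.
    have : vpick H != 0 by rewrite vpick0.
    case/row_neq0_coord=> c hc; exists c; apply/existsP; exists (vpick H).
    by rewrite memv_pick hc oner_eq0.
  (* [c] is the least coordinate at which some element of [H] is nonzero; [i] will be its block. *)
  case: (arg_minnP val nzc0) => c /existsP[h0 /andP[h0H h0c]] minc.
  have [i /andP[lec ltc]] := hlm_D_block (ltn_ord c).
  exists i, h0 => //; split.
    move=> h hH; rewrite -[RHS](_ : hlm_prefix i (0 : G) = 0); last first.
      by apply/rowP=> k; rewrite !mxE.
    apply/hlm_prefixP=> b ltb; rewrite mxE; apply/eqP/negPn/negP=> hb.
    have nzb : nz b by apply/existsP; exists h; rewrite hH.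
    by have := minc b nzb; rewrite leqNgt (leq_trans ltb lec).
  have [k ck] := block_coordP lec ltc; apply: contra h0c => /eqP/rowP/(_ k).
  by rewrite !mxE -/(block_coord k) -ck => ->.
pose xii x := xi (hlm_prefix i x).
(* On [P] the character that level [i] induces along [x + H] is nontrivial, as [h0] shows; its
   frequency is [t x] below. *)
pose P := [set x : G | dotp (hlm_block i h0) (xii x) != 0].
have cP : (2 ^ hlm_D s <= 8 * #|P|)%N.
  have := block_nonorth (admissible_xi i) y0.
  set A := [set u | _] => cA; have := card_prefix_preim A.
  have -> : [set x | hlm_prefix i x \in A] = P by apply/setP=> x; rewrite !inE.
  have : (0 < 2 ^ hlm_D i)%N by rewrite expn_gt0.
  by move: cA; move: (2 ^ _)%N (2 ^ _)%N #|A| #|P| => a b c d; nia.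
pose t x := block_embed (xii x).
have tE x h : dotp (t x) h = dotp (hlm_block i h) (xii x) by apply: dotp_block_embed.
have t_perp x : x \in P -> t x \notin perp H.
  rewrite inE => Px; rewrite inE; apply/negP=> /forall_inP/(_ _ h0H).
  by rewrite tE (negbTE Px).
pose fhat x : R := coset_fourier (hlm_witness xi) H x (t x).
(* The contribution of level [j] to the coefficient. The constant halves of the indicators cancel
   for [x] in [P]. *)
pose g j x := \sum_(h in H) level_sign xi R j (x + h) * sgn2 R (dotp (t x) h).
have cH : 0 < #|H|%:R :> R by rewrite ltr0n; apply/card_gt0P; exists 0; apply: mem0v.
have sR : 0 < s%:R :> R by rewrite ltr0n.
have fhatE x : x \in P -> 2%:R * s%:R * #|H|%:R * fhat x = \sum_j g j x.
  move=> xP; rewrite /fhat /coset_fourier.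
  transitivity (\sum_(h in H) \sum_j
      (1 + level_sign xi R j (x + h)) * sgn2 R (dotp (t x) h)).
    rewrite mulrA mulfK ?gt_eqF // mulr_sumr; apply: eq_bigr => h _.
    rewrite /hlm_witness mulrA mulrA mulfK ?gt_eqF // mulr_sumr mulr_suml.
    apply: eq_bigr => j _; rewrite level_signE mulrCA mulfV ?mulr1 //.
    by rewrite pnatr_eq0.
  rewrite exchange_big; apply: eq_bigr => j _ /=; rewrite /g.
  under eq_bigr do rewrite mulrDl mul1r.
  by rewrite big_split /= sum_sgn2_perp ?t_perp // add0r.
have g_norm j x : `|g j x| <= #|H|%:R.
  apply: le_trans (ler_norm_sum _ _ _) _; rewrite -sum1_card natr_sum.
  by apply: ler_sum => h _; rewrite normrM !sgn2_abs mulr1.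
have fhat_norm x : x \in P -> 2%:R * `|fhat x| <= 1.
  move=> xP; rewrite -(ler_pM2l (mulr_gt0 sR cH)) mulr1.
  have -> : s%:R * #|H|%:R * (2%:R * `|fhat x|) = `|\sum_j g j x|.
    rewrite -fhatE // !normrM !normr_nat; ring.
  apply: le_trans (ler_norm_sum _ _ _) _; rewrite -[s in s%:R]card_ord.
  rewrite -sum1_card natr_sum mulr_suml; apply: ler_sum => j _.
  by rewrite mul1r.
have gi x : g i x = level_sign xi R i x * #|H|%:R.
  rewrite /g -sum1_card natr_sum mulr_sumr; apply: eq_bigr => h hH.
  rewrite /level_sign /level_phase hlm_prefixD (H_prefix h hH) addr0 hlm_blockD.
  by rewrite dotpDl sgn2D tE -/(xii x) -mulrA sgn2_sqr.
(* A level below [i] is constant along the coset, so it meets a vanishing character sum at each [x].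
   A level above [i] cancels only after summing over [P], all other factors being functions of its
   prefix. *)
have gother j : j != i ->
    \sum_(x in P) level_sign xi R i x * g j x = 0.
  rewrite -val_eqE neq_ltn => /orP[ltji|ltij].
    apply: big1 => x xP; rewrite /g.
    rewrite (eq_bigr (fun h => level_sign xi R j x * sgn2 R (dotp (t x) h))).
      by rewrite -mulr_sumr sum_sgn2_perp ?t_perp // !mulr0.
    move=> h hH; have e : hlm_prefix i (x + h) = hlm_prefix i x.
      by rewrite hlm_prefixD (H_prefix h hH) addr0.
    have [e1 e2] := hlm_prefix_lt ltji e.
    by rewrite /level_sign /level_phase e1 e2.
  rewrite /g; under eq_bigr do rewrite mulr_sumr.
  rewrite exchange_big /=; apply: big1 => h hH.
  under eq_bigr do rewrite mulrA mulrAC.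
  apply: level_sign_orth => // x y /(hlm_prefix_lt ltij)[e1 e2].
  by rewrite !inE /t /xii /level_sign /level_phase e1 e2.
have sumP : \sum_(x in P) level_sign xi R i x * (2%:R * s%:R * #|H|%:R * fhat x) =
    #|P|%:R * #|H|%:R.
  under eq_bigr => x xP do rewrite fhatE // mulr_sumr.
  rewrite exchange_big (bigD1 i) //= [X in _ + X]big1 ?addr0 => [|j]; last first.
    exact: gother.
  rewrite -sum1_card natr_sum mulr_suml; apply: eq_bigr => x _.
  by rewrite gi mulrA sgn2_sqr.
pose nu := #|[set x | ~~ uniform_coset eps (hlm_witness xi) H x]|.
(* Points of uniform cosets have a coefficient of at most [eps]; the at most [nu] others get the
   bound 1/2 of [fhat_norm]. *)
have : #|P|%:R <= 2%:R * s%:R * eps * #|P|%:R + s%:R * nu%:R :> R.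
  rewrite -(ler_pM2r cH) -sumP.
  apply: (@le_trans _ _ (\sum_(x in P) s%:R * #|H|%:R * (2%:R * `|fhat x|))).
    apply: ler_sum => x _; apply: le_trans (ler_norm _) _.
    rewrite normrM sgn2_abs mul1r !normrM !normr_nat.
    by rewrite le_eqVlt; apply/orP; left; apply/eqP; ring.
  rewrite -mulr_sumr.
  have -> : (2%:R * s%:R * eps * #|P|%:R + s%:R * nu%:R) * #|H|%:R =
     s%:R * #|H|%:R * (2%:R * eps * #|P|%:R + nu%:R) by ring.
  rewrite ler_pM2l ?mulr_gt0 // /nu -!sum1_card !natr_sum mulr_sumr.
  rewrite [X in _ <= _ + X]big_mkcond /=.
  apply: (@le_trans _ _ (\sum_(x in P)
    (2%:R * eps * 1 + if x \in [set x | ~~ uniform_coset eps (hlm_witness xi) H x]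
                      then 1 else 0))).
    apply: ler_sum => x xP; rewrite inE mulr1; case: ifPn => [_|].
      by rewrite ler_wpDl ?fhat_norm // mulr_ge0 ?ltW.
    rewrite negbK => /forallP/(_ (t x)); rewrite t_perp //= addr0 => ?.
    by rewrite ler_pM2l.
  rewrite big_split /= lerD2l [X in X <= _]big_mkcond; apply: ler_sum => x _.
  by case: (x \in P); case: ifP.
have cPR : #|{: G}|%:R <= 8%:R * #|P|%:R :> R.
  by rewrite -natrM ler_nat card_rowF2.
have P0 : 0 < #|P|%:R :> R.
  by rewrite ltr0n; move: cP; case: #|P| => //; rewrite muln0 leqNgt expn_gt0.
move: regH; rewrite /regular -/nu => leN leP.
(* With [nu] at most [8 * eps * #|P|], the two terms are at most 1/8 and 1/2 of [#|P|], a
   contradiction. *)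
have se : s%:R * eps <= 16%:R^-1.
  by rewrite -(@ler_pM2l _ 16%:R) ?ltr0n // mulrA mulfV ?pnatr_eq0.
have l1 : s%:R * nu%:R <= 16%:R^-1 * (8%:R * #|P|%:R) :> R.
  apply: le_trans (ler_wpM2l (ltW sR) leN) _; rewrite [leLHS]mulrA.
  by rewrite ler_pM ?ler0n // mulr_ge0 // ltW.
have l2 : s%:R * eps * #|P|%:R <= 16%:R^-1 * #|P|%:R :> R by rewrite ler_pM2r.
by lra.
Qed.

Lemma reg_hlm_witness : (reg eps (hlm_witness xi) = 2 ^ hlm_D s)%N.
Proof.
have [[H regH ->] _] := regP (hlm_witness xi) (ltW eps_gt0).
have -> : H = 0%VS by apply/eqP; apply: contraLR regH => /not_regular.
by rewrite /codim dimv0 subn0 dimvf dim_matrix mul1r.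
Qed.

End Regularity.

(** * The number of levels containing a point *)

Section LevelCount.
Variables (s : nat) (xi : hlm_maps s).
Local Notation G := 'rV['F_2]_(hlm_D s).
Implicit Types (P : pred 'I_s) (x : G).

Definition level_count P x : nat := \sum_(j | P j) (x \in hlm_level xi j).

Hypothesis xi_neq0 : forall (j : 'I_s) u, xi (i := j) u != 0.

Lemma level_sign_uncorrelated (R : numFieldType) i j : i != j ->
  \sum_(x : G) level_sign xi R i x * level_sign xi R j x = 0.
Proof.
wlog ltij : i j / (i < j)%N => [IH ij|_].
  have := ij; rewrite -val_eqE neq_ltn => /orP[/IH|ltji]; first exact.
  under eq_bigr do rewrite mulrC.
  by apply: IH; rewrite // eq_sym.
have pre x y : hlm_prefix j x = hlm_prefix j y ->
    predT x = predT y /\ level_sign xi R i x = level_sign xi R i y.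
  by move=> /(hlm_prefix_lt ltij)[e1 e2]; rewrite /level_sign /level_phase e1 e2.
apply: etrans (level_sign_orth 0 (xi_neq0 (j := j)) pre).
by apply: eq_bigr => x _; rewrite addr0.
Qed.

Lemma level_second_moment (R : numFieldType) P :
  \sum_(x : G) (\sum_(j | P j) level_sign xi R j x) ^+ 2 = #|P|%:R * #|{: G}|%:R.
Proof.
under eq_bigr do rewrite expr2 mulr_suml.
rewrite exchange_big -sum1_card natr_sum mulr_suml /=.
apply: eq_bigr => j Pj; rewrite mul1r.
under eq_bigr do rewrite mulr_sumr.
rewrite exchange_big (bigD1 j) //= [X in _ + X]big1 ?addr0 => [|i /andP[_ ij]].
  rewrite -sum1_card natr_sum; apply: eq_bigr => x _; exact: sgn2_sqr.
by rewrite level_sign_uncorrelated // eq_sym.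
Qed.

Lemma level_count_le P x : (level_count P x <= #|P|)%N.
Proof. by rewrite -sum1_card; apply: leq_sum => j _; case: (x \in _). Qed.

(** Absolute difference, through truncated subtraction. *)
Definition gap (a b : nat) : nat := (a - b + (b - a))%N.

(** [2 * level_count P x - #|P|] is the sum of the level signs, so [level_second_moment] applies. *)
Lemma level_count_variance P :
  (\sum_(x : G) gap (2 * level_count P x) #|P| ^ 2 = #|P| * #|{: G}|)%N.
Proof.
apply/eqP; rewrite -(eqr_nat rat) natrM -level_second_moment natr_sum.
apply/eqP/eq_bigr => x _; rewrite natrX.
have -> : \sum_(j | P j) level_sign xi rat j x =
    2%:R * (level_count P x)%:R - #|P|%:R.
  rewrite /level_count -sum1_card !natr_sum mulr_sumr -sumrB; apply: eq_bigr => j _.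
  by rewrite level_signE mulrCA mulfV // mulr1 addrC addKr.
rewrite /gap; case: (leqP (2 * level_count P x) #|P|) => [le|/ltnW le].
  by rewrite (eqP le) add0n natrB // natrM -sqrrN opprB.
by rewrite (eqP le) addn0 natrB // natrM.
Qed.

Lemma card_gap_lt q M : (M <= q)%N -> (#|[set c : 'I_q.+1 | gap (2 * c) q < M]| <= M)%N.
Proof.
(* [lo] is the least [c] with [q - M < 2 * c]; the elements of [A] lie in an open interval of length
   [M]. *)
move=> leMq; set A := [set c | _]; pose lo := (q - M).+2./2.
have lo_le (c : 'I_q.+1) : c \in A -> (lo <= c)%N /\ (c - lo < M)%N.
  by rewrite inE /gap /lo; lia.
case: M leMq @lo A lo_le => [|M] leMq lo A lo_le.
  rewrite leqn0 cards_eq0 -subset0; apply/subsetP=> c /lo_le[_].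
  by rewrite ltn0.
rewrite -[leqRHS]card_ord -(@card_in_imset _ _ (fun c : 'I_q.+1 => inord (c - lo) : 'I_M.+1)).
  exact: max_card.
move=> c c' /lo_le[h1 h2] /lo_le[h3 h4] /(congr1 val) /=.
by rewrite !inordK // => e; apply: val_inj; rewrite /= -(subnK h1) e subnK.
Qed.

(* Chebyshev and pigeonhole: the count is within [M] of its mean for most
   points, and only [M] values lie that close. *)
Lemma level_count_popular P M : (M <= #|P|)%N -> exists2 c, (c <= #|P|)%N &
  ((M ^ 2 - #|P|) * #|{: G}| <= M ^ 3 * #|[set x | level_count P x == c]|)%N.
Proof.
set q := #|P|; move=> leMq.
pose w (c : 'I_q.+1) := #|[set x | level_count P x == c]|.
pose c0 := [arg max_(c > (ord0 : 'I_q.+1)) w c].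
have w_max c : (w c <= w c0)%N by rewrite /c0; case: arg_maxnP => // c1 _; apply.
exists c0; first by rewrite -ltnS.
(* The truncated difference vanishes outside the window [gap < M], so this sum only sees points
   inside it. *)
have lo : ((M ^ 2 - q) * #|{: G}| <= \sum_(x : G) (M ^ 2 - gap (2 * level_count P x) q ^ 2))%N.
  rewrite mulnBl -level_count_variance leq_subLR -big_split /=.
  by rewrite mulnC -sum_nat_const leq_sum // => x _; rewrite -leq_subLR.
apply: leq_trans lo _.
have cntx x : (level_count P x < q.+1)%N by rewrite ltnS level_count_le.
rewrite (partition_big (fun x => Ordinal (cntx x)) predT) //=.
apply: (@leq_trans (\sum_(c in [set c : 'I_q.+1 | gap (2 * c) q < M]) (w c0 * M ^ 2))%N).
  rewrite [leqRHS]big_mkcond; apply: leq_sum => c _.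
  rewrite inE; case: ltnP => [_|leM].
    apply: (@leq_trans (w c * M ^ 2)%N); last by rewrite leq_mul2r w_max orbT.
    rewrite /w -sum_nat_const big_mkcond [leqRHS]big_mkcond; apply: leq_sum => x _.
    rewrite inE -val_eqE /=; case: ifP => // _; exact: leq_subr.
  rewrite leqn0; apply/eqP; apply: big1 => x /eqP ec.
  by apply/eqP; rewrite subn_eq0 leq_sqr; move: leM; rewrite -ec.
rewrite sum_nat_const -/(w c0) (expnS M 2) -mulnA (mulnC (M ^ 2)%N).
exact: leq_mul (card_gap_lt leMq) (leqnn _).
Qed.

End LevelCount.

(** * Ladders in the last block *)

Lemma widen_ord_inj m n (lemn : (m <= n)%N) : injective (widen_ord lemn).
Proof. by move=> i j /(congr1 val) /= e; apply: val_inj. Qed.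

Lemma card_ord_lt n m : (m <= n)%N -> #|[pred i : 'I_n | (i < m)%N]| = m.
Proof.
move=> lemn; rewrite -[RHS]card_ord -(card_imset predT (@widen_ord_inj _ _ lemn)).
apply: eq_card => i; apply/idP/imsetP => [ltim|[j _ ->]]; last exact: (ltn_ord j).
by exists (Ordinal ltim) => //; apply: val_inj.
Qed.

Section LastBlock.
Variable s : nat.
Local Notation G := 'rV['F_2]_(hlm_D s.+1).
Local Notation U := 'rV['F_2]_(hlm_D s).
Local Notation V := 'rV['F_2]_(hlm_d s.+1).
Implicit Types (x : G) (u : U) (z : V).

Definition last_prefix x : U := hlm_prefix (ord_max : 'I_s.+1) x.
Definition last_block x : V := hlm_block (ord_max : 'I_s.+1) x.
Definition low_point u : G := prefix_embed (i := (ord_max : 'I_s.+1)) u.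
Definition top_point z : G := block_embed (i := (ord_max : 'I_s.+1)) z.
Definition before_last (j : 'I_s.+1) : bool := (j < s)%N.

Lemma last_prefix_block_inj x y :
  last_prefix x = last_prefix y -> last_block x = last_block y -> x = y.
Proof.
rewrite /last_prefix => /(hlm_prefixP ord_max) ep /rowP eb; apply/rowP=> c.
case: (ltnP c (hlm_D s)) => [ltc|lec]; first exact: ep.
have [k ->] := @block_coordP _ (ord_max : 'I_s.+1) c lec (ltn_ord c).
by have := eb k; rewrite !mxE.
Qed.

Lemma last_prefix_point u z : last_prefix (low_point u + top_point z) = u.
Proof. by rewrite /last_prefix hlm_prefixD prefix_embedK hlm_prefix_embed addr0. Qed.

Lemma last_block_point u z : last_block (low_point u + top_point z) = z.
Proof.
rewrite /last_block hlm_blockD hlm_block_embed -[RHS]add0r; congr (_ + _).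
apply/rowP=> k; rewrite !mxE /low_point /prefix_embed summxE.
apply: big1 => l _; rewrite !mxE eqxx /= -val_eqE /= eq_sym.
by rewrite ltn_eqF ?mulr0 // ltn_addr.
Qed.

Lemma point_inj u v z w :
  low_point u + top_point z = low_point v + top_point w -> u = v /\ z = w.
Proof.
move=> e; split; first by rewrite -(last_prefix_point u z) e last_prefix_point.
by rewrite -(last_block_point u z) e last_block_point.
Qed.

Lemma card_last_prefix (A : {set G}) :
  (#|A| <= #|[set last_prefix x | x in A]| * 2 ^ hlm_d s.+1)%N.
Proof.
rewrite -card_rowF2 -cardsT -cardsX.
have injq : injective (fun x => (last_prefix x, last_block x)).
  by move=> x y [/last_prefix_block_inj]; apply.
rewrite -(card_imset _ injq); apply: subset_leq_card.
by apply/subsetP=> _ /imsetP[x xA ->]; rewrite in_setX inE imset_f.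
Qed.

Lemma level_count_prefix (xi : hlm_maps s.+1) x y :
  last_prefix x = last_prefix y ->
  level_count xi before_last x = level_count xi before_last y.
Proof.
move=> e; apply: eq_bigr => j ltj.
by have [e1 e2] := hlm_prefix_lt (ltj : (j < (ord_max : 'I_s.+1))%N) e; rewrite !inE e1 e2.
Qed.

(** Where exactly [c] earlier levels contain [x], the last level alone decides; hence the numerator
    [c.+1]. *)
Lemma mem_superlevel (R : realType) (xi : hlm_maps s.+1) c x :
  (c.+1%:R / s.+1%:R <= hlm_witness xi x :> R) =
  (c < level_count xi before_last x +
       (dotp (last_block x) (xi ord_max (last_prefix x)) == 0)%R)%N.
Proof.
rewrite /hlm_witness [leRHS]mulrC ler_pM2r ?invr_gt0 ?ltr0n // -natr_sum ler_nat.
congr (_ < _)%N; rewrite (bigID before_last) /=; congr (_ + _)%N.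
rewrite (big_pred1 ord_max) => [|j]; first by rewrite inE.
rewrite /before_last -leqNgt; apply/idP/eqP => [lej|-> //].
by apply: val_inj; apply/eqP; rewrite eqn_leq lej -ltnS ltn_ord.
Qed.

Section Ladder.
Variables (S B : {set G}) (k : nat) (g : 'I_(hlm_d s.+1) -> U).
Variable Q : 'M['F_2]_(hlm_d s.+1).
Hypotheses (k_gt0 : (0 < k)%N) (le_kd : (16 * k <= hlm_d s.+1)%N).
Hypotheses (Qunit : Q \in unitmx) (inj_g : injective g).
Hypothesis SP : forall (i : 'I_(hlm_d s.+1)) z, (i < 16 * k)%N ->
  (low_point (g i) + top_point z \in S) = (dotp z (row i Q) == 0).
Hypothesis leB : (#|B| <= k * 2 ^ hlm_d s.+1)%N.

(** Above the points [g i] with [i] in [T], the set [S] traces [W z] and [B] traces [E z], of total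
    size at most [#|B|]. Listing the elements of a shattered set and cutting out its initial
    segments gives the ladder. *)
Lemma perturbed_ladder : has_ladder (symdiff S B) k.
Proof.
pose pt i z := low_point (g i) + top_point z.
pose T := [set i : 'I_(hlm_d s.+1) | (i < 16 * k)%N].
(* All indices are used, beyond those in [T], so that invertibility of [Q] makes [W] injective. *)
pose W z := [set i : 'I_(hlm_d s.+1) | dotp z (row i Q) == 0].
pose E z := [set i in T | pt i z \in B].
have cT : #|T| = (16 * k)%N by rewrite cardsE card_ord_lt.
have injW : injective W.
  have QT : Q^T \in unitmx by rewrite unitmx_tr.
  move=> z z' /setP eW; apply: (can_inj (mulmxK QT)).
  have dotQ y : y *m Q^T = \row_i dotp y (row i Q).
    by apply/rowP=> i; rewrite !mxE; apply: eq_bigr => l _; rewrite !mxE.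
  rewrite !dotQ; apply/rowP=> i; rewrite !mxE; have := eW i; rewrite !inE.
  by case: (F2_cases (dotp z (row i Q))) (F2_cases (dotp z' (row i Q))) => -> [] ->.
have cZ : #|{: V}| = (2 ^ #|'I_(hlm_d s.+1)|)%N by rewrite card_rowF2 card_ord.
have sET z : E z \subset T by apply/subsetP=> i; rewrite inE => /andP[].
have sumE : (\sum_z #|E z| <= k * #|{: V}|)%N.
  apply: (@leq_trans #|B|); last by rewrite cZ card_ord.
  under eq_bigr do rewrite -sum1_card.
  rewrite pair_big_dep /= sum1dep_card.
  have injpt : injective (fun zi : V * 'I_(hlm_d s.+1) => pt zi.2 zi.1).
    by move=> [z i] [z' i'] /= /point_inj[/inj_g -> ->].
  rewrite -(card_imset _ injpt); apply: subset_leq_card.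
  by apply/subsetP=> _ /imsetP[[z i] /= + ->]; rewrite !inE => /andP[].
have [K sKT [cK shK]] := perturbed_shatters k_gt0 cT injW cZ sET sumE.
pose e (p : 'I_k) : 'I_(hlm_d s.+1) := enum_val (cast_ord (esym cK) p).
have eK p : e p \in K by apply: enum_valP.
have inj_e : injective e by move=> p q /enum_val_inj/cast_ord_inj.
pose A (q : 'I_k) := [set e p | p : 'I_k & (p <= q)%N].
have /fin_all_exists[z zE] q : exists z, ((W z :\: E z) :|: (E z :\: W z)) :&: K = A q.
  by apply: shK; apply/subsetP=> _ /imsetP[p _ ->].
apply/existsP; exists [ffun p => low_point (g (e p))].
apply/existsP; exists [ffun q => top_point (z q)].
apply/'forall_forallP => p q; rewrite !ffunE.
have eT : e p \in T by apply: (subsetP sKT).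
have -> : (p <= q)%N = (e p \in A q).
  apply/idP/imsetP=> [lepq|[p' + /inj_e ->]]; last by rewrite inE.
  by exists p; rewrite ?inE.
rewrite -zE in_setI eK andbT /symdiff !inE -/(pt (e p) (z q)).
have lt_ep : (e p < 16 * k)%N by move: eT; rewrite inE.
by rewrite SP // lt_ep /=.
Qed.

End Ladder.
End LastBlock.

(** * Sizes of the last block and of a popular fibre *)

Lemma nat_sqrt_exists n : exists r, (r ^ 2 <= n < r.+1 ^ 2)%N.
Proof.
elim: n => [|n [r /andP[le lt]]]; first by exists 0%N.
case: (ltnP n.+1 (r.+1 ^ 2)) => [lt'|le'].
  by exists r; rewrite lt' (leq_trans le).
exists r.+1; rewrite le' /= !expnS !expn0 !muln1 in lt *; nia.
Qed.

Lemma twr_gt0 r : (0 < twr r)%N.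
Proof. by case: r => // r; rewrite /= expn_gt0. Qed.

(** The slack [i + 6] is spent in [last_block_ge_twr]: 3 on the shift in the block size, [i + 3] on
    the factor [8 * i.+1]. *)
Lemma hlm_D_ge_twr i : (4 <= i)%N -> (twr i.-1 + i + 6 <= hlm_D i)%N.
Proof.
elim: i => // i IHi; rewrite leq_eqVlt => /predU1P[<-|].
  have -> : hlm_D 4 = (11 + 2 ^ 8)%N by [].
  have -> : twr 4.-1 = (2 ^ 4)%N by [].
  lia.
rewrite ltnS => i4; have {}IHi := IHi i4; case: i i4 IHi => // i i4 IHi.
have i3 : (3 <= i.+1)%N by apply: leq_trans i4.
rewrite -[hlm_D i.+2]/(hlm_D i.+1 + hlm_d i.+2)%N hlm_d_large //.
rewrite -[twr i.+2.-1]/(2 ^ twr i)%N; rewrite -[i.+1.-1]/i in IHi.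
have le2 : (2 ^ twr i <= 2 ^ (hlm_D i.+1 - 3))%N by rewrite leq_exp2l //; lia.
have twr0 := twr_gt0 i.
move: le2; set a := (2 ^ twr i)%N; set b := (2 ^ (_ - 3))%N => le2.
by move: (hlm_D i.+1) IHi => e IHi; lia.
Qed.

Section Size.
Variable s : nat.
Hypothesis s15 : (15 <= s)%N.

Lemma last_block_divisible : (32 %| hlm_d s.+1)%N.
Proof.
have s3 : (3 <= s)%N by apply: leq_trans s15.
rewrite hlm_d_large // -[32%N]/(2 ^ 5)%N dvdn_exp2l //.
by have := hlm_D_ge11 s3; lia.
Qed.

Lemma last_block_ge_twr : (8 * s.+1 * twr s <= hlm_d s.+1)%N.
Proof.
have s3 : (3 <= s)%N by apply: leq_trans s15.
have s4 : (4 <= s)%N by apply: leq_trans s15.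
have := hlm_D_ge_twr s4; rewrite hlm_d_large //.
case: s s15 => // t t15; rewrite -[t.+1.-1]/t -[twr t.+1]/(2 ^ twr t)%N => le.
apply: (@leq_trans (2 ^ (3 + t.+1 + twr t))).
  rewrite !expnD leq_mul2r; apply/orP; right.
  rewrite leq_mul2l /=; exact: ltn_expl.
by rewrite leq_exp2l //; lia.
Qed.

Lemma last_block_ge : (32 * s.+1 <= hlm_d s.+1)%N.
Proof.
apply: leq_trans last_block_ge_twr; rewrite (_ : (32 = 8 * 4)%N) // -mulnA.
rewrite -mulnA leq_mul2l /= mulnC leq_mul2l /=.
case: s s15 => [|[|[|t]]] // _; rewrite -[4%N]/(2 ^ 2)%N leq_exp2l //.
by rewrite /= -[2%N]/(2 ^ 1)%N leq_exp2l // expn_gt0.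
Qed.

(** [k] is [hlm_d s.+1 / (8 * sqrt s.+1)] rounded up, with inequalities squared; [m] will be
    [16 * k]. As 32 divides the block size and [16 <= s.+1], one thirty-second of the block size is
    a candidate, which bounds the minimum. *)
Lemma rung_exists : exists k,
  [/\ (0 < k)%N, (hlm_d s.+1 ^ 2 <= 64 * s.+1 * k ^ 2)%N,
      (64 * s.+1 * k.-1 ^ 2 < hlm_d s.+1 ^ 2)%N & (32 * k <= hlm_d s.+1)%N].
Proof.
have := last_block_ge; have /dvdnP[e ->] := last_block_divisible => ge.
pose P k := ((e * 32) ^ 2 <= 64 * s.+1 * k ^ 2)%N.
have Pe : P e by rewrite /P expnMn; move: (e ^ 2)%N => f; nia.
have exP : exists k, P k by exists e.
case: (ex_minnP exP) => k Pk mink; exists k.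
have k0 : (0 < k)%N.
  by rewrite lt0n; apply: contraTneq Pk => ->; rewrite /P -ltnNge; nia.
split=> //.
  by rewrite ltnNge; apply/negP=> /mink; rewrite -ltnS prednK // ltnn.
by rewrite [leqRHS]mulnC leq_mul2l /= mink.
Qed.

(* With [r = floor (sqrt s.+1)], the window [M = 2 * r] in
   [level_count_popular] leaves a fibre of relative size at least [5 / (16 r)]. *)
Lemma popular_fiber (xi : hlm_maps s.+1) k :
  (forall (j : 'I_s.+1) u, xi j u != 0) ->
  (64 * s.+1 * k.-1 ^ 2 < hlm_d s.+1 ^ 2)%N -> (0 < k)%N ->
  exists2 c, (c <= s)%N & (16 * k <=
    #|[set last_prefix x | x in [set x | level_count xi (@before_last s) x == c]]|)%N.
Proof.
move=> xi0 ltk k0; have [r /andP[ler ltr]] := nat_sqrt_exists s.+1.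
have cP : #|@before_last s| = s.
  exact: card_ord_lt (leqnSn s).
have r4 : (4 <= r)%N by rewrite leqNgt; apply/negP=> r3; move: ltr; rewrite ltnNge => /negP; apply;
  apply: leq_trans (_ : 4 ^ 2 <= _)%N; [rewrite leq_sqr | rewrite ltnS].
have leM : (2 * r <= #|@before_last s|)%N.
  by rewrite cP; move: ler; rewrite expnS expn1; nia.
have [c lec] := level_count_popular xi0 leM; rewrite cP in lec *.
set A := [set x | _] => popA; exists c => //.
have s3 : (3 <= s)%N by apply: leq_trans s15.
have cG : #|{: 'rV['F_2]_(hlm_D s.+1)}| = (8 * hlm_d s.+1 * 2 ^ hlm_d s.+1)%N.
  by rewrite card_rowF2 -hlm_d_mul8 // -expnD.
have := card_last_prefix A; set U := #|[set last_prefix x | x in A]| => cA.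
have N0 : (0 < 2 ^ hlm_d s.+1)%N by rewrite expn_gt0.
have dge := last_block_ge.
(* From [s < r ^ 2 + 2 * r] and [4 <= r] follows [2 * s <= 3 * r ^ 2]. *)
have coef : (5 * r ^ 2 <= 2 * ((2 * r) ^ 2 - s))%N.
  by move: ltr; rewrite !expnMn !expnS !expn0; nia.
have popd : (5 * hlm_d s.+1 <= 2 * r * U)%N.
  rewrite -(leq_pmul2r N0) -(@leq_pmul2r (8 * r ^ 2)) ?muln_gt0 ?expn_gt0 //; last first.
    by rewrite (leq_trans _ r4).
  have h1 := leq_mul coef (leqnn #|{: 'rV['F_2]_(hlm_D s.+1)}|).
  have h2 : (2 * ((2 * r) ^ 2 - s) * #|{: 'rV['F_2]_(hlm_D s.+1)}| <=
             2 * ((2 * r) ^ 3 * (U * 2 ^ hlm_d s.+1)))%N.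
    by rewrite -mulnA leq_mul2l /=; apply: leq_trans popA _; rewrite leq_mul2l cA orbT.
  have := leq_trans h1 h2; rewrite cG.
  by move: (hlm_d s.+1) (2 ^ hlm_d s.+1)%N => d N; rewrite !expnMn !expnS !expn0; lia.
have r0 : (0 < 2 * r)%N by rewrite muln_gt0 (leq_trans _ r4).
rewrite -(leq_pmul2l r0); apply: leq_trans popd.
(* Rounding up costs little: [32 * r * k] equals [4 * (8 * r * k.-1) + 32 * r], and [32 * r] is at
   most one more block size. *)
have : (8 * r * k.-1 < hlm_d s.+1)%N.
  rewrite -ltn_sqr; apply: leq_ltn_trans ltk.
  by rewrite !expnMn leq_mul2r -[64%N]/(8 ^ 2)%N leq_mul2l ler !orbT.
have : (r <= s.+1)%N by apply: leq_trans ler; rewrite expnS expn1 leq_pmulr // (leq_trans _ r4).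
move: dge k0; case: k {ltk} => // k; move: (hlm_d _) => d /=; nia.
Qed.

End Size.

(** * Alignment of the last map and assembly *)

(* The last map may be precomposed with a permutation, so that the popular
   fibre is sent to linearly independent vectors. *)
Lemma align_last_map s (xi0 : hlm_maps s.+1) m (A : {set 'rV['F_2]_(hlm_D s)}) :
  hlm_admissible xi0 -> (m <= #|A|)%N -> (m <= hlm_d s.+1)%N ->
  exists (xi : hlm_maps s.+1) (g : 'I_(hlm_d s.+1) -> 'rV['F_2]_(hlm_D s))
         (Q : 'M['F_2]_(hlm_d s.+1)),
    [/\ hlm_admissible xi, forall j, before_last j -> xi j = xi0 j,
        Q \in unitmx /\ injective g, forall i, xi ord_max (g i) = row i Q &
        forall i : 'I_(hlm_d s.+1), (i < m)%N -> g i \in A].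
Proof.
move=> adm0 lemA lemd; pose last : 'I_s.+1 := ord_max.
have [f0 spf injf _ _] : block_admissible (xi0 last) := adm0 last.
pose M : 'M['F_2]_(#|{: 'rV['F_2]_(hlm_D s)}|, hlm_d s.+1) :=
  \matrix_i (xi0 last (enum_val i)).
have rowM i : row i M = xi0 last (enum_val i) by apply/rowP=> j; rewrite !mxE.
have fullM : row_full M.
  apply: orth0_row_full => y yM; apply: (span_orth0 spf) => v.
  by rewrite mem_enum => /imsetP[u _ ->]; rewrite -[u]enum_rankK -rowM yM.
pose rho i : 'rV['F_2]_(hlm_D s) := enum_val (fullrankfun fullM i).
have inj_rho : injective rho by move=> i j /enum_val_inj/fullrankfun_inj.
pose tau (i : 'I_m) : 'rV['F_2]_(hlm_D s) := enum_val (widen_ord lemA i).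
have inj_tau : injective tau.
  by move=> i j /enum_val_inj/(congr1 val) /= e; apply: val_inj.
(* The images of the points [rho i] form a basis; [p] sends [m] points of [A] to the first [m] of
   them. *)
have [p pE] := perm_interpolation inj_tau
  (g := rho \o widen_ord lemd) (inj_comp inj_rho (@widen_ord_inj _ _ lemd)).
pose xi : hlm_maps s.+1 := dfwith xi0 (i := last) (xi0 last \o p).
exists xi, (fun i => (p^-1)%g (rho i)), (rowsub (fullrankfun fullM) M); split.
- move=> i; change (block_admissible (xi i)); have [->|ne] := eqVneq i last.
    by rewrite /xi dfwith_in; exact: (block_admissible_perm p (adm0 last)).
  by rewrite /xi dfwith_out 1?eq_sym //; apply: adm0.
- move=> j ltj; rewrite /xi dfwith_out // -val_eqE /= neq_ltn.
  by rewrite [X in _ || X]ltj orbT.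
- by split; [exact: fullrowsub_unit | move=> i j /perm_inj/inj_rho].
- by move=> i; rewrite /xi dfwith_in /= permKV row_rowsub rowM.
move=> i ltim; have -> : rho i = p (tau (Ordinal ltim)).
  by rewrite pE /=; congr rho; apply: val_inj.
by rewrite permK enum_valP.
Qed.

(** Perturbing [S] by [symdiff S C] returns [C], so a stable [C] within [eps] of [S] would contain a
    ladder. *)
Lemma dist_gt_of_ladders (R : realType) (G : finZmodType) (eps : R) (S : {set G}) k :
  (0 < k)%N ->
  (forall B : {set G}, #|B|%:R <= eps * #|G|%:R -> has_ladder (symdiff S B) k) ->
  eps < dist S (stable_sets G k) :> R.
Proof.
move=> k0 lad; have ne : stable_sets G k != set0.
  by apply/set0Pn; exists set0; apply: stable_sets_set0.
have [[C Cst ->] _] := distP R S ne.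
have G0 : (0 : R) < #|G|%:R by rewrite ltr0n; apply/card_gt0P; exists 0.
rewrite ltNge; apply/negP; rewrite ler_pdivrMr // => /lad.
have -> : symdiff S (symdiff S C) = C.
  by apply/setP=> x; rewrite !inE; case: (x \in S); case: (x \in C).
by move: Cst; rewrite inE => /negP.
Qed.

Theorem theorem5p2 (R : realType) (eps : R) (s : nat)
  (eps_gt0 : 0 < eps) (eps_le : eps <= 1 / 256%:R)
  (s_def : s%:Z = Num.floor (1 / (16%:R * eps))) :
  exists (xi : hlm_maps s) (c0 m : nat),
    let f : 'rV['F_2]_(hlm_D s) -> R := hlm_witness xi in
    let theta : R := c0.+1%:R / s%:R in
    let S : {set 'rV['F_2]_(hlm_D s)} := [set x | theta <= f x] in
    let d : R := (hlm_d s)%:R in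
    [/\ hlm_admissible xi,
        (c0 < s)%N,
        [/\ (16 %| m)%N, 2%:R * d / Num.sqrt s%:R <= m%:R & m%:R <= d / 2%:R],
        [/\ m%:R / 16%:R <= (ldr_star eps S)%:R :> R,
            d / (8%:R * Num.sqrt s%:R) <= m%:R / 16%:R
          & (twr (s - 2))%:R <= d / (8%:R * Num.sqrt s%:R)]
      & eps < dist S (stable_sets 'rV['F_2]_(hlm_D s) (m %/ 16)) /\
        (reg eps f = 2 ^ hlm_D s)%N /\ (twr s <= 2 ^ hlm_D s)%N].
Proof.
have eps16 : 0 < 16%:R * eps by rewrite mulr_gt0 ?ltr0n.
have s16 : (16 <= s)%N.
  rewrite -lez_nat s_def floor_ge_int ler_pdivlMr //.
  have : 256%:R * eps <= 1 by rewrite mulrC -ler_pdivlMr ?ltr0n.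
  by apply: le_trans; rewrite mulrA ler_pM2r // -natrM ler_nat.
have s_eps : 16%:R * s%:R * eps <= 1.
  have : s%:R <= 1 / (16%:R * eps) by rewrite -[s%:R]/(s%:~R) s_def floor_le.
  by rewrite ler_pdivlMr // mulrA [s%:R * _]mulrC.
(* From here [s] counts the levels before the last one. *)
case: s s16 s_eps {s_def} => // s s15 s_eps; rewrite ltnS in s15.
have s3 : (3 <= s)%N by apply: leq_trans s15.
have [k [k0 dk kd le32]] := rung_exists s15.
have [xi0 adm0] := hlm_admissible_exists s.+1.
have xi0_neq0 (j : 'I_s.+1) u : xi0 j u != 0 by case: (adm0 j).
have [c0 lec0 leA] := popular_fiber s15 xi0_neq0 kd k0.
have le16 : (16 * k <= hlm_d s.+1)%N by apply: leq_trans le32; rewrite leq_mul2r orbT.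
have [xi [g [Q [adm eq_xi [Qunit inj_g] gE gA]]]] := align_last_map adm0 leA le16.
pose S : {set 'rV['F_2]_(hlm_D s.+1)} :=
  [set x | c0.+1%:R / s.+1%:R <= hlm_witness xi x :> R].
have SP (i : 'I_(hlm_d s.+1)) z : (i < 16 * k)%N ->
    (low_point (g i) + top_point z \in S) = (dotp z (row i Q) == 0).
  move=> /gA/imsetP[x + gx]; rewrite inE => /eqP cx.
  rewrite inE mem_superlevel last_block_point last_prefix_point gE.
  (* The fibre was found for [xi0], whose earlier levels [xi] shares. *)
  have -> : level_count xi (@before_last s) (low_point (g i) + top_point z) = c0.
    rewrite -cx (@level_count_prefix _ _ _ x) ?last_prefix_point //.
    by apply: eq_bigr => j ltj; rewrite !inE eq_xi.
  by case: eqP => _; rewrite ?addn1 ?addn0 ?ltnSn ?ltnn.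
have cG : #|{: 'rV['F_2]_(hlm_D s.+1)}| = (8 * hlm_d s.+1 * 2 ^ hlm_d s.+1)%N.
  by rewrite card_rowF2 -hlm_d_mul8 // -expnD.
(* Uses [16 <= s.+1]. It makes a set of density [eps], at most [1 / (16 * s.+1)], have at most
   [k * 2 ^ hlm_d s.+1] points. *)
have d2sk : (hlm_d s.+1 <= 2 * s.+1 * k)%N.
  rewrite -leq_sqr; apply: leq_trans dk _.
  rewrite !expnMn leq_mul2r; apply/orP; right.
  by rewrite (expnS s.+1 1) mulnA leq_mul2r; lia.
have lad (B : {set 'rV['F_2]_(hlm_D s.+1)}) :
    #|B|%:R <= eps * #|{: 'rV['F_2]_(hlm_D s.+1)}|%:R -> has_ladder (symdiff S B) k.
  move=> leB; apply: (perturbed_ladder k0 le16 Qunit inj_g SP).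
  rewrite -(ler_nat R) -(@ler_pM2l _ (16%:R * s.+1%:R)) ?mulr_gt0 ?ltr0n //.
  apply: (@le_trans _ _ #|{: 'rV['F_2]_(hlm_D s.+1)}|%:R).
    apply: le_trans (ler_wpM2l _ leB) _; first by rewrite mulr_ge0.
    by rewrite mulrA -[leRHS]mul1r ler_wpM2r.
  rewrite cG -!natrM ler_nat mulnA leq_mul2r; apply/orP; right.
  by rewrite (_ : 16 = 8 * 2)%N // -!mulnA leq_mul2l mulnA d2sk.
have sqrt_gt0 : 0 < Num.sqrt s.+1%:R :> R by rewrite sqrtr_gt0 ltr0n.
have d_le : (hlm_d s.+1)%:R <= k%:R * (8%:R * Num.sqrt s.+1%:R) :> R.
  rewrite -(ler_pXn2r (n := 2)) ?nnegrE ?mulr_ge0 ?(ltW sqrt_gt0) //.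
  rewrite !exprMn sqr_sqrtr // -!natrX -!natrM ler_nat.
  by apply: leq_trans dk _; rewrite mulnC.
have mE : (16 * k)%:R / 16%:R = k%:R :> R.
  by rewrite natrM mulrAC mulfV ?mul1r // pnatr_eq0.
exists xi, c0, (16 * k)%N; split=> //.
- split; first exact: dvdn_mulr.
    by rewrite ler_pdivrMr // natrM; move: d_le; lra.
  by rewrite ler_pdivlMr ?ltr0n // -natrM ler_nat mulnAC.
- rewrite mE; split=> //.
    have [[B leB ->] _] := ldr_starP S (ltW eps_gt0).
    by rewrite ler_nat; have [_] := ldrP (symdiff S B); apply; apply: lad.
    by rewrite ler_pdivrMr // mulr_gt0 ?ltr0n.
  rewrite ler_pdivlMr ?mulr_gt0 ?ltr0n //.
  have sqrt_le : Num.sqrt s.+1%:R <= s.+1%:R :> R.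
    by rewrite -[leRHS]ger0_norm // -sqrtr_sqr ler_wsqrtr // expr2 -natrM ler_nat leq_pmulr.
  apply: (@le_trans _ _ ((twr (s.+1 - 2))%:R * (8%:R * s.+1%:R))).
    by rewrite !ler_wpM2l.
  rewrite -!natrM ler_nat; apply: leq_trans (last_block_ge_twr s15).
  rewrite mulnC leq_mul2l; apply/orP; right; rewrite subSS subn1.
  by case: (s) => // t; apply/ltnW/ltn_expl.
rewrite mulKn //; split; first exact: dist_gt_of_ladders.
split; first exact: reg_hlm_witness.
rewrite -[twr s.+1]/(2 ^ twr s)%N leq_exp2l //.
by apply: leq_trans (hlm_D_ge_twr (s3 : (4 <= s.+1)%N)); rewrite -addnA leq_addr.
Qed.
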